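(* Let $d\ge2$, let $a,b\in\mathbb{R}$ satisfy $a<a_c$ and $a\le b< a+1$ if $d\ge3$, $a<b<a+1$ if $d=2$, and let $p:=\frac{2d}{d-2+2(b-a)}$. Let $u\in\mathcal{D}^{a,b}_{\mathrm{loc}}(\mathbb{R}^d)$ be a positive solution of $$\mathrm{div}\left(|x|^{-2a}\nabla u\right)+|x|^{-bp}|u|^{p-2}u=0\quad\text{in }\mathbb{R}^d,$$ and let $P\in C^3\left((0,+\infty)\times\mathbb{S}^{d-1}\right)$ be the associated pressure function. Then, in $(0,+\infty)\times\mathbb{S}^{d-1}$, $$\mathcal{L}P=\frac{2(n-1)^2}{n-2}P^{-1}+\frac n2|\mathrm{D}P|^2P^{-1}$$ and $$P^{1-n}\,\mathrm{k}[P]=\mathrm{D}_i\left(\frac12P^{1-n}\mathrm{D}_i|\mathrm{D}P|^2-\frac1nP^{1-n}\,\mathcal{L}P\,\mathrm{D}_iP\right).$$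
   Context: Notation. $a_c:=\frac{d-2}{2}$, $n:=\frac{d}{1+a-b}$ (a real number, $n>2$), $\alpha:=\frac{(1+a-b)(a_c-a)}{a_c-a+b}$; one has $p=\frac{2n}{n-2}$. $\mathcal{D}^{a,b}_{\mathrm{loc}}(\mathbb{R}^d)$ is the space of functions $u$ with $|x|^{-b}u\in L^p(K,dx)$ and $|x|^{-a}|\nabla u|\in L^2(K,dx)$ for every compact $K\subset\mathbb{R}^d$. Solutions are understood in the weak sense; positive solutions are smooth on $\mathbb{R}^d\setminus\{0\}$, and positive means $u>0$ there. Use spherical coordinates $r=|x|$, $\theta=x/|x|$, write $u(r,\theta)$, and define $w$ on $(0,+\infty)\times\mathbb{S}^{d-1}$ by $u(r,\theta)=w(r^\alpha,\theta)$. The pressure function is $$P:=(n-1)\,w^{-\frac{2}{n-2}} .$$ For functions $f,g$ of $(r,\theta)\in(0,+\infty)\times\mathbb{S}^{d-1}$, a prime denotes $\partial_r$, and $\nabla_\theta$, $\Delta_\theta$ are the gradient and Laplace–Beltrami operator of the round sphere $\mathbb{S}^{d-1}$. Set $$\mathrm{D}f=\left(\alpha f',\tfrac1r\nabla_\theta f\right),\quad \langle\mathrm{D}f,\mathrm{D}g\rangle=\alpha^2f'g'+\frac{\nabla_\theta f\cdot\nabla_\theta g}{r^2},\quad |\mathrm{D}f|^2=\langle\mathrm{D}f,\mathrm{D}f\rangle,$$ $$\mathcal{L}f=\mathrm{D}_i\mathrm{D}_if=\alpha^2f''+\alpha^2\frac{n-1}{r}f'+\frac{\Delta_\theta f}{r^2}.$$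 Repeated indices are summed, and $\mathrm{D}_iV_i$ denotes the corresponding weighted divergence: for $V=(V_0,V_\theta)$ with $V_0$ the radial component and $V_\theta$ tangent to the sphere, $\mathrm{D}_iV_i=\alpha r^{1-n}\partial_r(r^{n-1}V_0)+\frac1r\mathrm{div}_\theta V_\theta$; in particular $\mathrm{D}_i(f\,\mathrm{D}_ig)=\langle\mathrm{D}f,\mathrm{D}g\rangle+f\,\mathcal{L}g$. Finally $$\mathrm{k}[P]:=\frac12\mathcal{L}|\mathrm{D}P|^2-\langle\mathrm{D}P,\mathrm{D}\mathcal{L}P\rangle-\frac1n(\mathcal{L}P)^2 .$$ *)

(* Defs.v *)
From HB Require Import structures.
From mathcomp Require Import all_boot all_order all_algebra.
From mathcomp Require Import all_classical all_reals all_analysis.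

Set Implicit Arguments.
Unset Strict Implicit.
Unset Printing Implicit Defensive.

Import Order.TTheory GRing.Theory Num.Theory.
Import numFieldNormedType.Exports.

Local Open Scope classical_set_scope.
Local Open Scope ring_scope.

Section lebesgue_measure_Rd.
Context {R : realType}.
Local Notation RT := (measurableTypeR R).

Definition consT n (q : RT * n.-tuple RT) : n.+1.-tuple RT :=
  [the n.+1.-tuple RT of q.1 :: q.2].

Lemma measurable_consT n : measurable_fun [set: RT * n.-tuple RT] (@consT n).
Proof. exact: measurable_cons. Qed.

(* The product measure (Lebesgue on R) \x m, transported to R^(n+1). *)
Definition cons_measure n (m : {sigma_finite_measure set (n.-tuple RT) -> \bar R})
  : set (n.+1.-tuple RT) -> \bar R :=
  pushforward (@lebesgue_measure R \x m)%E (@consT n).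

Section cons_measure_instances.
Variables (n : nat) (m : {sigma_finite_measure set (n.-tuple RT) -> \bar R}).

Let cons_measure0 : cons_measure m set0 = 0%E.
Proof. by rewrite /cons_measure /pushforward preimage_set0 measure0. Qed.

Let cons_measure_ge0 A : (0 <= cons_measure m A)%E.
Proof. by rewrite /cons_measure /pushforward; exact: measure_ge0. Qed.

Let cons_measure_sigma_additive : semi_sigma_additive (cons_measure m).
Proof.
move=> F mF tF mUF; rewrite /cons_measure /pushforward preimage_bigcup.
apply: measure_semi_sigma_additive.
- by move=> k; rewrite -[X in measurable X]setTI; exact: measurable_consT.
- apply/trivIsetP => /= i j _ _ ij; rewrite -preimage_setI.
  by move/trivIsetP : tF => /(_ _ _ _ _ ij) ->//; rewrite preimage_set0.
- by rewrite -preimage_bigcup -[X in measurable X]setTI; exact: measurable_consT.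
Qed.

HB.instance Definition _ := isMeasure.Build _ _ _
  (cons_measure m) cons_measure0 cons_measure_ge0 cons_measure_sigma_additive.

Let cons_measure_sigma_finite : sigma_finite setT (cons_measure m).
Proof.
have [F FT Foo] : sigma_finite setT (@lebesgue_measure R \x m)%E.
  have /sigma_finiteP[A [TA ndA Aoo]] := sigma_finiteT (@lebesgue_measure R).
  have /sigma_finiteP[B [TB ndB Boo]] := sigma_finiteT m.
  exists (fun k => A k `*` B k).
    rewrite -setXTT TA TB predeqE => -[x y]; split.
      move=> [/= [i _ Ax] [k _ By]]; exists (maxn i k) => //; split.
      - by move: x Ax; exact/subsetPset/ndA/leq_maxl.
      - by move: y By; exact/subsetPset/ndB/leq_maxr.
    by move=> [k _ []/= ? ?]; split; exists k.
  move=> k; have [? ?] := Aoo k; have [? ?] := Boo k.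
  split; first exact: measurableX.
  by rewrite product_measure1E// lte_mul_pinfty// ge0_fin_numE.
pose g (t : n.+1.-tuple RT) : RT * n.-tuple RT := (thead t, [tuple of behead t]).
have mg : measurable_fun setT g.
  apply/measurable_fun_pair; first exact: measurable_tnth.
  exact: measurable_behead.
exists (fun i => g @^-1` F i).
  by rewrite -preimage_bigcup -FT preimage_setT.
move=> i; have [mF Fi] := Foo i; split.
  by rewrite -[X in measurable X]setTI; exact: mg.
rewrite /cons_measure /pushforward.
suff -> : @consT n @^-1` (g @^-1` F i) = F i by [].
have gK q : g (consT q) = q.
  by case: q => x t; congr pair; apply: val_inj.
by apply/seteqP; split => q /=; rewrite gK.
Qed.

HB.instance Definition _ := Measure_isSigmaFinite.Build _ _ _
  (cons_measure m) cons_measure_sigma_finite.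

End cons_measure_instances.

(* d-dimensional Lebesgue measure, as the d-fold product of the
   one-dimensional one. *)
Fixpoint leb d : {sigma_finite_measure set (d.-tuple RT) -> \bar R} :=
  if d is d'.+1 then cons_measure (leb d') : {sigma_finite_measure set _ -> \bar R}
  else dirac [tuple] : {sigma_finite_measure set _ -> \bar R}.

End lebesgue_measure_Rd.

Section euclidean_space.
Context {R : realType} {d : nat}.
Implicit Types (x y : 'rV[R]_d) (f g phi : 'rV[R]_d -> R).

Definition dotrv x y : R := \sum_(i < d) x 0 i * y 0 i.

(* The norm [`|x|] that the library puts on row vectors is the sup norm;
   [enorm] is the Euclidean one. *)
Definition enorm x : R := Num.sqrt (dotrv x x).

Definition partial (i : 'I_d) f : 'rV[R]_d -> R :=
  fun x => 'D_(delta_mx 0 i) f x.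

Definition gradient f x : 'rV[R]_d := \row_i partial i f x.

(* f is of class C^k on the open set U. *)
Fixpoint Ck (k : nat) (U : set 'rV[R]_d) f : Prop :=
  (forall x, U x -> {for x, continuous f}) /\
  (if k is k'.+1 then
     forall i : 'I_d,
       (forall x, U x -> derivable f x (delta_mx 0 i)) /\ Ck k' U (partial i f)
   else True).

Definition punctured : set 'rV[R]_d := [set x | x != 0].

(* phi belongs to C_c^oo(U). *)
Definition test_function (U : set 'rV[R]_d) phi : Prop :=
  (forall k, Ck k setT phi) /\
  (exists2 K, compact K /\ K `<=` U & forall x, ~ K x -> phi x = 0).

(* The measure [leb d] lives on d-tuples. *)
Definition vec (t : d.-tuple (measurableTypeR R)) : 'rV[R]_d :=
  \row_i (tnth t i : R).

Definition intRd f : R := (\int[leb d]_t f (vec t))%R.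

Definition in_Lloc (p : R) (U : set 'rV[R]_d) f : Prop :=
  forall K, compact K -> K `<=` U -> ((f \_ K) \o vec) \in Lfun (leb d) p%:E.

(* G is the distributional gradient of u on R^d \ {0}.  The origin is removed
   because membership in D^{a,b}_loc does not make u or its gradient locally
   integrable there when a and b are very negative; this is immaterial
   otherwise, as points are removable for d >= 2. *)
Definition weak_gradient (u : 'rV[R]_d -> R) (G : 'rV[R]_d -> 'rV[R]_d) : Prop :=
  [/\ in_Lloc 1 punctured u,
      forall i, in_Lloc 1 punctured (fun x => G x 0 i) &
      forall phi, test_function punctured phi -> forall i,
        intRd (fun x => u x * partial i phi x) =
        - intRd (fun x => G x 0 i * phi x)].

End euclidean_space.

Section ckn.
Context {R : realType}.

Definition a_c (d : nat) : R := (d%:R - 2) / 2.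

Definition ckn_p (d : nat) (a b : R) : R :=
  2 * d%:R / (d%:R - 2 + 2 * (b - a)).

Definition ckn_n (d : nat) (a b : R) : R := d%:R / (1 + a - b).

Definition ckn_alpha (d : nat) (a b : R) : R :=
  (1 + a - b) * (a_c d - a) / (a_c d - a + b).

Definition Dloc (d : nat) (a b : R) (u : 'rV[R]_d -> R) : Prop :=
  in_Lloc (ckn_p d a b) setT (fun x => enorm x `^ (- b) * u x) /\
  exists2 G, weak_gradient u G &
    in_Lloc 2 setT (fun x => enorm x `^ (- a) * enorm (G x)).

(* div(|x|^{-2a} grad u) + |x|^{-bp} |u|^{p-2} u = 0 weakly in R^d. *)
Definition weak_solution (d : nat) (a b : R) (u : 'rV[R]_d -> R) : Prop :=
  let p := ckn_p d a b in
  exists2 G, weak_gradient u G &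
    forall phi, test_function setT phi ->
      intRd (fun x => enorm x `^ (- (2 * a)) * dotrv (G x) (gradient phi x)) =
      intRd (fun x =>
        enorm x `^ (- (b * p)) * (`|u x| `^ (p - 2) * u x) * phi x).

End ckn.

Section sphere.
Context {R : realType} {d : nat}.

Definition sphere : set 'rV[R]_d := [set theta | enorm theta = 1].

(* 0-homogeneous extension to R^d \ {0} of a map defined on the sphere. *)
Definition hext {T : Type} (g : 'rV[R]_d -> T) : 'rV[R]_d -> T :=
  fun x => g ((enorm x)^-1 *: x).

(* At a point of the sphere, the Euclidean gradient of the 0-homogeneous
   extension is tangent to the sphere and is the Riemannian gradient. *)
Definition grad_theta (g : 'rV[R]_d -> R) : 'rV[R]_d -> 'rV[R]_d :=
  fun theta => gradient (hext g) theta.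

(* The differential of the 0-homogeneous extension of V kills the normal
   direction, so its trace is the trace of the tangential derivative of V, i.e.
   the Riemannian divergence when V is tangent. *)
Definition div_theta (V : 'rV[R]_d -> 'rV[R]_d) : 'rV[R]_d -> R :=
  fun theta => \sum_(i < d) partial i (fun x => hext V x 0 i) theta.

Definition laplace_beltrami (g : 'rV[R]_d -> R) : 'rV[R]_d -> R :=
  div_theta (grad_theta g).

End sphere.

Section weighted_operators.
Context {R : realType} {d : nat}.
(* Functions of (r, theta); only their values for 0 < r and theta on the unit
   sphere matter. *)
Local Notation fct := (R -> 'rV[R]_d -> R).
Implicit Types f g P w : fct.

(* Class C^k on (0, +oo) x S^{d-1}, through the diffeomorphism
   x |-> (|x|, x/|x|) from R^d \ {0}. *)
Definition Ck_polar (k : nat) f : Prop :=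
  Ck k punctured (fun x => f (enorm x) ((enorm x)^-1 *: x)).

Definition dr f : fct := fun r theta => derive1 (fun s => f s theta) r.

Variables (alpha n : R).

Definition Dop f : R -> 'rV[R]_d -> R^o * 'rV[R]_d :=
  fun r theta => (alpha * dr f r theta, r^-1 *: grad_theta (f r) theta).

Definition Ddot f g : fct := fun r theta =>
  alpha ^+ 2 * dr f r theta * dr g r theta +
  dotrv (grad_theta (f r) theta) (grad_theta (g r) theta) / r ^+ 2.

Definition Dsq f : fct := Ddot f f.

Definition Lop f : fct := fun r theta =>
  alpha ^+ 2 * dr (dr f) r theta + alpha ^+ 2 * ((n - 1) / r) * dr f r theta +
  laplace_beltrami (f r) theta / r ^+ 2.

Definition Ddiv (V : R -> 'rV[R]_d -> R^o * 'rV[R]_d) : fct := fun r theta =>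
  alpha * r `^ (1 - n) * dr (fun s t => s `^ (n - 1) * (V s t).1) r theta +
  r^-1 * div_theta (fun t => (V r t).2) theta.

Definition pressure w : fct := fun r theta =>
  (n - 1) * w r theta `^ (- (2 / (n - 2))).

Definition kop P : fct := fun r theta =>
  2^-1 * Lop (Dsq P) r theta - Ddot P (Lop P) r theta -
  n^-1 * Lop P r theta ^+ 2.

End weighted_operators.

(* Main.v *)
From HB Require Import structures.
Require Import Defs.
From mathcomp Require Import all_boot all_order all_algebra.
From mathcomp Require Import all_classical all_reals all_analysis.
From mathcomp Require Import measurable_realfun ring lra.

(* Since P is C^3, so is u away from the origin. Testing the weak equation with
   phi supported there, using phi |-> |x|^{-2a} d_i phi in the definition of the
   weak gradient and integrating by parts twice, shows that the equation holds
   pointwise. In polar coordinates and in the variable s = r^alpha it becomes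
   L w + w^{(n+2)/(n-2)} = 0, which is the first identity once w is expressed
   through P. For the second one, expand the divergence by the Leibniz rule;
   what remains is <DP, D(P L P)> = (n/2) <DP, D|DP|^2>, obtained by
   differentiating the first identity multiplied by P. *)

Set Implicit Arguments.
Unset Strict Implicit.
Unset Printing Implicit Defensive.

Import Order.TTheory GRing.Theory Num.Theory.
Import numFieldNormedType.Exports.

Local Open Scope classical_set_scope.
Local Open Scope ring_scope.

(** * Partial derivatives and the classes C^k *)

(** Two obstacles shape the development. The weights are powers of |x|, possibly singular at 0, so
    the equation is tested only away from the origin, where they are smooth. And the sphere is
    handled without charts: angular derivatives are the ambient derivations [tang i] of
    0-homogeneous extensions, tied by sum_i theta_i [tang i] f = 0. The angular gradient and
    Laplacian then become finite sums of products, and each computation ends as field algebra in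
    values of [dr] and [tang]. The substitution s = r^alpha is dictated by two relations: alpha (n -
    2) = d - 2 - 2a turns the first-order radial coefficient into n - 1, and -bp + 2a + 2 = 2 alpha
    makes the nonlinear term scale like the second-order one. The power in the pressure is the one
    for which w^(p-2) is a constant multiple of P^-2, so that P L P is a constant plus a multiple of
    |DP|^2. In the second identity the terms in L|DP|^2 and (L P)^2 are the same on both sides, so
    only first derivatives of P, |DP|^2 and L P have to be compared; class C^3 makes L P
    differentiable. *)

Section directional_derivatives.
Context {R : realType} {V : normedModType R}.
Implicit Types (f g : V -> R) (x v : V).

Lemma is_derive_mul f g x v (df dg : R) :
  is_derive x v f df -> is_derive x v g dg ->
  is_derive x v (fun y => f y * g y) (df * g x + f x * dg).
Proof.
move=> hf hg; apply: (@is_derive_eq _ _ _ (f * g)).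
by rewrite addrC /GRing.scale /= (mulrC df).
Qed.

Lemma is_derive_invr f x v (df : R) : f x != 0 ->
  is_derive x v f df -> is_derive x v (fun y => (f y)^-1) (- (f x)^-1 ^+ 2 * df).
Proof.
move=> f0 [hf <-]; apply: DeriveDef; first exact: derivableV.
by rewrite deriveV// exprVn.
Qed.

Lemma is_derive_oppr f x v (df : R) :
  is_derive x v f df -> is_derive x v (fun y => - f y) (- df).
Proof. by move=> hf; exact: is_deriveN. Qed.

Lemma is_derive_add f g x v (df dg : R) :
  is_derive x v f df -> is_derive x v g dg ->
  is_derive x v (fun y => f y + g y) (df + dg).
Proof. by move=> hf hg; exact: is_deriveD. Qed.

Lemma is_derive_bigsum n (f : 'I_n -> V -> R) x v (df : 'I_n -> R) :
  (forall i, is_derive x v (f i) (df i)) ->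
  is_derive x v (fun y => \sum_(i < n) f i y) (\sum_(i < n) df i).
Proof.
move=> h; have := is_derive_sum h.
by rewrite fct_sumE.
Qed.

(** Restricting to the line through x reduces directional derivatives to functions of one real
    variable, where the chain rule and the mean value theorem are available. *)
Lemma derive_line f x v : 'D_v f x = 'D_1 (fun k : R => f (k *: v + x)) 0.
Proof.
rewrite /derive; set g1 := fun h => h^-1 *: _; set g2 := fun h => h^-1 *: _.
suff -> : g1 = g2 by [].
by rewrite funeqE /g1 /g2 => t /=; rewrite addr0 scale0r add0r [_%:A]mulr1.
Qed.

Lemma derivable_line f x v :
  derivable f x v -> derivable (fun k : R => f (k *: v + x)) 0 1.
Proof. by move=> h; exact: (derivable1P f x v).1 h. Qed.

Lemma line_derivable f x v :
  derivable (fun k : R => f (k *: v + x)) 0 1 -> derivable f x v.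
Proof. by move=> h; exact: (derivable1P f x v).2 h. Qed.

(** Derivability of f along v suffices: on the line through x both factors are functions of one
    variable, for which derivable and differentiable coincide. *)
Lemma is_derive_comp1 (h : R -> R) f x v (dh df : R) :
  is_derive (f x) (1 : R) h dh -> is_derive x v f df ->
  is_derive x v (fun y => h (f y)) (dh * df).
Proof.
move=> [hh hdh] [hf hdf].
have dc : derivable (fun k : R => f (k *: v + x)) 0 1.
  exact: derivable_line hf.
have e0 : f (0 *: v + x) = f x by rewrite scale0r add0r.
have dh' : derivable h (f (0 *: v + x)) 1.
  by rewrite e0; exact: hh.
apply: DeriveDef.
  apply: line_derivable; apply/derivable1_diffP.
  apply: (@differentiable_comp _ _ _ _ (fun k : R => f (k *: v + x)) h).
    exact: (derivable1_diffP _ _).1 dc.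
  exact: (derivable1_diffP _ _).1 dh'.
have := derive1_comp dc dh'.
by rewrite !derive1E e0 hdh derive_line -hdf (derive_line f).
Qed.

Lemma is_derive_chain m (F : 'rV[R]_m -> R) (c : V -> 'rV[R]_m) x v
    (l : 'I_m -> R) :
  differentiable F (c x) ->
  (forall j, is_derive x v (fun y => c y 0 j) (l j)) ->
  is_derive x v (fun y => F (c y)) (\sum_(j < m) partial j F (c x) * l j).
Proof.
move=> dF hc.
pose c1 (k : R) := c (k *: v + x).
have c10 : c1 0 = c x by rewrite /c1 scale0r add0r.
have dc j : derivable (fun k : R => c1 k 0 j) 0 1.
  by have [h _] := hc j; exact: (@derivable_line (fun y => c y 0 j)).
have dc1 : derivable c1 0 1.
  by apply/derivable_mxP => i j; rewrite (ord1 i).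
have dc1' : differentiable c1 0.
  exact: (derivable1_diffP _ _).1 dc1.
have dF' : differentiable F (c1 0) by rewrite c10.
have dFc : differentiable (F \o c1) 0 by apply: differentiable_comp.
apply: DeriveDef.
  by apply: line_derivable; exact: (derivable1_diffP _ _).2 dFc.
have E : 'D_1 (F \o c1) (0 : R) = 'd F (c1 0) ('d c1 (0 : R) 1).
  by rewrite (deriveE _ dFc) (diff_comp dc1' dF').
rewrite derive_line; apply: (etrans E).
rewrite -(deriveE _ dc1') c10 (derive_mx dc1).
set r := (\matrix_(_, _) _ : 'rV[R]_m).
rewrite [r]row_sum_delta linear_sum; apply: eq_bigr => j _.
rewrite linearZ /= mulrC; congr (_ * _); last by rewrite -(deriveE _ dF).
by have [_ <-] := hc j; rewrite mxE (derive_line (fun y => c y 0 j)).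
Qed.

Lemma continuous_at_mul f g x :
  {for x, continuous f} -> {for x, continuous g} ->
  {for x, continuous (fun y => f y * g y)}.
Proof. exact: continuousM. Qed.

Lemma continuous_at_add f g x :
  {for x, continuous f} -> {for x, continuous g} ->
  {for x, continuous (fun y => f y + g y)}.
Proof. exact: continuousD. Qed.

Lemma continuous_at_cst (c : R) x : {for x, continuous (fun _ : V => c)}.
Proof. exact: cst_continuous. Qed.

Lemma continuous_at_bigsum n (f : 'I_n -> V -> R) x :
  (forall i, {for x, continuous (f i)}) ->
  {for x, continuous (fun y => \sum_(i < n) f i y)}.
Proof.
move=> cf; rewrite (_ : (fun y => _) = \sum_(i < n) f i); last by rewrite fct_sumE.
elim/big_ind : _ => // [|g h cg ch]; first exact: cvg_cst.
exact: continuousD.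
Qed.

End directional_derivatives.

(** * Continuous partial derivatives imply differentiability *)

Section C1_differentiable.
Context {R : realType} {d : nat}.
Implicit Types (f g : 'rV[R]_d -> R) (x h : 'rV[R]_d) (U : set 'rV[R]_d).

Lemma continuous_at_coord i x : {for x, continuous (fun y : 'rV[R]_d => y 0 i)}.
Proof. exact/differentiable_continuous/differentiable_coord. Qed.

Lemma normr_coord x i : `|x 0 i| <= `|x|.
Proof.
rewrite [leRHS]/Num.Def.normr/= mx_normrE.
exact: (le_bigmax _ (fun ij : 'I_1 * 'I_d => `|x ij.1 ij.2|) (0, i)).
Qed.

Lemma normr_rV_le x (e : R) : 0 <= e ->
  (forall i, `|x 0 i| <= e) -> `|x| <= e.
Proof.
move=> e0 H; rewrite [leLHS]/Num.Def.normr/= mx_normrE (bigmax_le _ e0)//.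
by move=> [i j] _; rewrite (ord1 i).
Qed.

(** Vertices of the staircase from 0 to h that moves along one coordinate axis at a time. *)
Definition row_trunc (j : nat) h : 'rV[R]_d :=
  \row_i (if (i < j)%N then h 0 i else 0).

Lemma row_trunc0 h : row_trunc 0 h = 0.
Proof. by apply/rowP => i; rewrite !mxE. Qed.

Lemma row_truncS (j : 'I_d) h :
  row_trunc j.+1 h = row_trunc j h + h 0 j *: delta_mx 0 j.
Proof.
apply/rowP => i; rewrite !mxE eqxx /= ltnS leq_eqVlt (val_eqE i j).
by case: eqVneq => [->|_] /=; rewrite ?ltnn ?mulr1 ?add0r// mulr0 addr0.
Qed.

Lemma row_trunc_full h : row_trunc d h = h.
Proof. by apply/rowP => i; rewrite !mxE ltn_ord. Qed.

Lemma normr_row_trunc (j : 'I_d) h (t : R) : `|t| <= `|h 0 j| ->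
  `|row_trunc j h + t *: delta_mx 0 j| <= `|h|.
Proof.
move=> th; apply: normr_rV_le => // i; rewrite !mxE eqxx /=.
case: (eqVneq i j) => [->|_] /=.
  by rewrite ltnn add0r mulr1 (le_trans th)// normr_coord.
by rewrite mulr0 addr0; case: ifP => _; rewrite ?normr0// normr_coord.
Qed.

(** The increment t may have either sign, as it will be a coordinate of h; hence the intermediate
    point is located by its absolute value only. *)
Lemma partial_MVT f x (v : 'rV[R]_d) (t : R) :
  (forall s : R, `|s| <= `|t| -> derivable f (x + s *: v) v) ->
  exists2 s : R, `|s| <= `|t| & f (x + t *: v) - f x = 'D_v f (x + s *: v) * t.
Proof.
move=> df; pose g (s : R) := f (x + s *: v).
have dg (s : R) : `|s| <= `|t| -> is_derive s (1 : R) g ('D_v f (x + s *: v)).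
  move=> st; have [] := derivableP (df _ st).
  move=> /derivable_line h1 _; rewrite derive_line.
  have e : (fun k : R => f (k *: v + (x + s *: v))) = (fun k : R => g (k *: (1 : R) + s)).
    by apply/funext => k; rewrite /g addrCA -scalerDl /GRing.scale /= mulr1.
  rewrite e in h1 *; apply: DeriveDef; first exact: (derivable1P g s 1).2 h1.
  by rewrite -derive_line.
have cg (s : R) : `|s| <= `|t| -> {for s, continuous g}.
  by move=> /dg[+ _]; move/derivable1_diffP/differentiable_continuous.
have [t0|t0] := leP 0 t.
- have [||s] := @MVT_segment R g (fun s => 'D_v f (x + s *: v)) 0 t t0.
  + move=> s; rewrite in_itv /= => /andP[s0 st]; apply: dg.
    by rewrite !ger0_norm // ltW.
  + apply: continuous_in_subspaceT => s; rewrite inE /= in_itv /= => /andP[s0 st].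
    by apply: cg; rewrite !ger0_norm.
  rewrite in_itv /= => /andP[s0 st]; rewrite /g scale0r addr0 subr0 => ->.
  by exists s => //; rewrite !ger0_norm.
- have [||s] := @MVT_segment R g (fun s => 'D_v f (x + s *: v)) t 0 (ltW t0).
  + move=> s; rewrite in_itv /= => /andP[s0 st]; apply: dg.
    by rewrite !ler0_norm ?lerN2 // ltW.
  + apply: continuous_in_subspaceT => s; rewrite inE /= in_itv /= => /andP[s0 st].
    by apply: cg; rewrite !ler0_norm ?lerN2 // ltW.
  rewrite in_itv /= => /andP[s0 st]; rewrite /g scale0r addr0 sub0r => E.
  exists s; first by rewrite !ler0_norm ?lerN2 // ltW.
  by apply: oppr_inj; rewrite opprB E mulrN.
Qed.

(** The increment of f is telescoped along the staircase [row_trunc]. Each step is a partial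
    derivative at an intermediate point, by the mean value theorem, and continuity of the partials
    brings it close to its value at x. All intermediate points stay within sup distance |h| of x. *)
Lemma Ck1_differentiable U f x : open U -> Ck 1 U f -> U x ->
  differentiable f x.
Proof.
move=> oU [cf df] Ux.
pose Lf (h : 'rV[R]_d) : R := \sum_(i < d) h 0 i * partial i f x.
have Lf_lin : linear Lf.
  move=> a h1 h2; rewrite /Lf scaler_sumr -big_split /=; apply: eq_bigr => i _.
  by rewrite !mxE mulrDl; congr (_ + _); rewrite /GRing.scale /= mulrA.
pose LfM := GRing.isLinear.Build _ _ _ _ Lf Lf_lin.
pose L : {linear 'rV[R]_d -> R} := HB.pack Lf LfM.
have cL : continuous L.
  suff : continuous (Lf : 'rV[R]_d -> R) by [].
  move=> h; apply: continuous_at_bigsum => i.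
  by apply: continuous_at_mul; [exact: continuous_at_coord|exact: continuous_at_cst].
suff H : f \o shift x = cst (f x) + L +o_ (0 : 'rV[R]_d) id.
  have dE : 'd f x = L :> (_ -> _) := diff_unique cL H.
  by apply/diff_locallyP; rewrite dE; split; [exact: cL|exact: H].
apply/eqaddoP => _/posnumP[e].
(* The error e is shared among d steps; dividing by d + 1 avoids a null denominator when d = 0. *)
have e1 : 0 < e%:num / d.+1%:R by rewrite divr_gt0.
have [D D0 hD] : exists2 D : R, 0 < D & forall y, `|y| < D -> U (x + y) /\
    forall j, `|partial j f x - partial j f (x + y)| <= e%:num / d.+1%:R.
  have : \forall y \near x, U y /\
      forall j, `|partial j f x - partial j f y| <= e%:num / d.+1%:R.
    have nU : \forall y \near x, U y by apply: open_nbhs_nbhs.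
    have nj : \forall y \near x,
        forall j, `|partial j f x - partial j f y| <= e%:num / d.+1%:R.
      have FF : Filter (nbhs x) by typeclasses eauto.
      apply: (@filter_forall 'rV[R]_d 'I_d (fun j y =>
        `|partial j f x - partial j f y| <= e%:num / d.+1%:R) (nbhs x) FF) => j.
      have [_ [cj _]] := df j.
      by have /cvgrPdist_le := cj _ Ux; exact.
    by move: nj; apply: filterS2 nU => y; split.
  move=> /nbhs_ballP[D D0 hD]; exists D => // y yD; apply: hD.
  by rewrite -ball_normE /= opprD addNKr normrN.
have nD : \forall y \near (0 : 'rV[R]_d), `|y| < D.
  apply/nbhs_ballP; exists D => //= y.
  by rewrite -ball_normE /= sub0r normrN.
near=> h => /=.
have hD' : `|h| < D by near: h; exact: nD.
change (`|f (h + x) - (f x + Lf h)| <= e%:num * `|h|).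
(* Telescoping sum along the staircase, with the linear part distributed over its steps. *)
have -> : f (h + x) - (f x + Lf h) =
  \sum_(j < d) ((f (x + row_trunc j.+1 h) - f (x + row_trunc j h)) -
     h 0 j * partial j f x).
  rewrite sumrB -(big_mkord xpredT (fun j => f (x + row_trunc j.+1 h) -
    f (x + row_trunc j h))) (telescope_sumr (fun j => f (x + row_trunc j h)))//.
  rewrite row_trunc0 row_trunc_full addr0 opprD addrA.
  by rewrite /= (addrC h x).
apply: (@le_trans _ _ (\sum_(j < d) (e%:num / d.+1%:R * `|h|))); last first.
  rewrite sumr_const card_ord -[leLHS]mulr_natl mulrA ler_wpM2r//.
  by rewrite mulrCA ler_piMr// ler_pdivrMr// mul1r ler_nat.
apply: (le_trans (ler_norm_sum _ _ _)); apply: ler_sum => j _.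
have [|s sh] := @partial_MVT f (x + row_trunc j h) (delta_mx 0 j) (h 0 j).
  move=> s /normr_row_trunc sh; apply: (df j).1.
  by rewrite -addrA; have [] := hD _ (le_lt_trans sh hD').
rewrite row_truncS addrA => ->.
rewrite mulrC -mulrBr normrM mulrC ler_pM//.
- rewrite distrC -addrA; apply: (hD _ _).2.
  exact: le_lt_trans (normr_row_trunc sh) hD'.
- exact: normr_coord.
Unshelve. all: by end_near. Qed.

End C1_differentiable.

Lemma continuous_at_rV {R : realType} {V : normedModType R} m
    (c : V -> 'rV[R]_m) (x : V) :
  (forall j, {for x, continuous (fun y => c y 0 j)}) -> {for x, continuous c}.
Proof.
move=> hc; apply/cvgrPdist_le => /= e e0.
have FF : Filter (nbhs x) by typeclasses eauto.
have H : \forall y \near x, forall j : 'I_m, `|c x 0 j - c y 0 j| <= e.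
  apply: (@filter_forall V 'I_m (fun j y => `|c x 0 j - c y 0 j| <= e)
    (nbhs x) FF) => j.
  by have /cvgrPdist_le := hc j; exact.
apply: filterS H => y H; apply: normr_rV_le; first exact: ltW.
by move=> i; rewrite !mxE.
Qed.

(** * Stability of the classes C^k under algebraic operations and composition *)

Section Ck_calculus.
Context {R : realType} {d : nat}.
Implicit Types (f g : 'rV[R]_d -> R) (x : 'rV[R]_d) (U : set 'rV[R]_d).

Lemma Ck_continuous k U f x : Ck k U f -> U x -> {for x, continuous f}.
Proof. by case: k => [|k] [cf _]; exact: cf. Qed.

Lemma Ck_derivable k U f x i : Ck k.+1 U f -> U x ->
  derivable f x (delta_mx 0 i).
Proof. by move=> [_ df] Ux; apply: (df i).1. Qed.

Lemma Ck_is_derive k U f x i : Ck k.+1 U f -> U x ->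
  is_derive x (delta_mx 0 i) f (partial i f x).
Proof. by move=> cf Ux; apply: derivableP; exact: Ck_derivable cf Ux. Qed.

Lemma Ck_partial k U f i : Ck k.+1 U f -> Ck k U (partial i f).
Proof. by move=> [_ df]; exact: (df i).2. Qed.

Lemma CkW k l U f : (l <= k)%N -> Ck k U f -> Ck l U f.
Proof.
elim: k l f => [|k IH] [|l] f //= lk [cf df]; first by split.
by split=> // i; split; [exact: (df i).1|apply: IH => //; exact: (df i).2].
Qed.

Lemma Ck_subset k U U' f : U `<=` U' -> Ck k U' f -> Ck k U f.
Proof.
move=> UU'; elim: k f => [|k IH] f /= [cf df]; split => //.
- by move=> x /UU'; exact: cf.
- by move=> x /UU'; exact: cf.
- move=> i; split; first by move=> x /UU'; exact: (df i).1.
  by apply: IH; exact: (df i).2.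
Qed.

(** All conditions in [Ck] are pointwise, so they can be glued. This serves to extend by zero a
    product with a compactly supported factor. *)
Lemma Ck_setU k U U' f : Ck k U f -> Ck k U' f -> Ck k (U `|` U') f.
Proof.
elim: k f => [|k IH] f /= [cf df] [cf' df']; split => //.
- by move=> x [Ux|Ux]; [exact: cf|exact: cf'].
- by move=> x [Ux|Ux]; [exact: cf|exact: cf'].
- move=> i; split; last by apply: IH; [exact: (df i).2|exact: (df' i).2].
  by move=> x [Ux|Ux]; [exact: (df i).1|exact: (df' i).1].
Qed.

Lemma Ck_differentiable k U f x : open U -> Ck k.+1 U f -> U x ->
  differentiable f x.
Proof. by move=> oU cf; apply: (@Ck1_differentiable _ _ U) => //; exact: CkW cf. Qed.

Lemma near_eq_open U f g x : open U -> (forall y, U y -> f y = g y) -> U x ->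
  \forall y \near x, f y = g y.
Proof.
move=> oU fg Ux.
have nU : \forall y \near x, U y by apply: open_nbhs_nbhs.
by apply: filterS nU.
Qed.

Lemma partial_eq U f g x i : open U -> (forall y, U y -> f y = g y) -> U x ->
  partial i f x = partial i g x.
Proof. by move=> oU fg Ux; exact/near_eq_derive/(near_eq_open oU fg Ux). Qed.

Lemma continuous_at_eq U f g x : open U -> (forall y, U y -> f y = g y) ->
  U x -> {for x, continuous f} -> {for x, continuous g}.
Proof.
move=> oU fg Ux; have h := near_eq_open oU fg Ux.
rewrite /prop_for /continuous_at (fg _ Ux) => cf.
by exact: cvg_trans (near_eq_cvg h) cf.
Qed.

Lemma Ck_eq k U f g : open U -> (forall x, U x -> f x = g x) ->
  Ck k U f -> Ck k U g.
Proof.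
move=> oU; elim: k f g => [|k IH] f g fg [cf df]; split => //.
- by move=> x Ux; exact: continuous_at_eq oU fg Ux (cf _ Ux).
- by move=> x Ux; exact: continuous_at_eq oU fg Ux (cf _ Ux).
- move=> i; split=> [x Ux|].
    by apply: near_eq_derivable ((df i).1 _ Ux); exact: near_eq_open oU fg Ux.
  apply: (IH (partial i f)); last exact: (df i).2.
  by move=> x Ux; exact: partial_eq oU fg Ux.
Qed.

(** Entry point for inductions on k: it is enough to exhibit formulas for the partial derivatives
    and to know their class. *)
Lemma CkS_intro k U f (df : 'I_d -> 'rV[R]_d -> R) : open U ->
  (forall x, U x -> {for x, continuous f}) ->
  (forall i x, U x -> is_derive x (delta_mx 0 i) f (df i x)) ->
  (forall i, Ck k U (df i)) -> Ck k.+1 U f.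
Proof.
move=> oU cf hf cdf; split=> // i; split => [x Ux|].
  by have [] := hf i x Ux.
apply: Ck_eq (cdf i) => // x Ux.
by rewrite /partial; have [_ ->] := hf i x Ux.
Qed.

Lemma Ck_cst k U (c : R) : open U -> Ck k U (fun=> c).
Proof.
move=> oU; elim: k c => [|k IH] c.
  by split => // x _; exact: continuous_at_cst.
apply: (CkS_intro (df := fun _ _ => 0)) => //.
by move=> x _; exact: continuous_at_cst.
Qed.

Lemma Ck_add k U f g : open U -> Ck k U f -> Ck k U g ->
  Ck k U (fun x => f x + g x).
Proof.
move=> oU; elim: k f g => [|k IH] f g cf cg.
  by split => // x Ux; apply: continuous_at_add;
    [exact: Ck_continuous cf Ux|exact: Ck_continuous cg Ux].
apply: (CkS_intro (df := fun i x => partial i f x + partial i g x)) => //.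
- by move=> x Ux; apply: continuous_at_add;
    [exact: Ck_continuous cf Ux|exact: Ck_continuous cg Ux].
- by move=> i x Ux; apply: is_derive_add;
    [exact: (Ck_is_derive _ cf Ux)|exact: (Ck_is_derive _ cg Ux)].
- by move=> i; apply: IH; exact: Ck_partial.
Qed.

Lemma Ck_mul k U f g : open U -> Ck k U f -> Ck k U g ->
  Ck k U (fun x => f x * g x).
Proof.
move=> oU; elim: k f g => [|k IH] f g cf cg.
  by split => // x Ux; apply: continuous_at_mul;
    [exact: Ck_continuous cf Ux|exact: Ck_continuous cg Ux].
apply: (CkS_intro (df := fun i x => partial i f x * g x + f x * partial i g x)) => //.
- by move=> x Ux; apply: continuous_at_mul;
    [exact: Ck_continuous cf Ux|exact: Ck_continuous cg Ux].
- by move=> i x Ux; apply: is_derive_mul;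
    [exact: (Ck_is_derive _ cf Ux)|exact: (Ck_is_derive _ cg Ux)].
- have cf' : Ck k U f by exact: CkW cf.
  have cg' : Ck k U g by exact: CkW cg.
  by move=> i; apply: Ck_add => //; apply: IH => //; exact: Ck_partial.
Qed.

Lemma Ck_opp k U f : open U -> Ck k U f -> Ck k U (fun x => - f x).
Proof.
move=> oU cf; apply: (@Ck_eq _ _ (fun x => -1 * f x)) => //.
  by move=> x _; rewrite mulN1r.
by apply: Ck_mul => //; exact: Ck_cst.
Qed.

Lemma Ck_sub k U f g : open U -> Ck k U f -> Ck k U g ->
  Ck k U (fun x => f x - g x).
Proof. by move=> oU cf cg; apply: Ck_add => //; exact: Ck_opp. Qed.

Lemma Ck_sum k U n (f : 'I_n -> 'rV[R]_d -> R) : open U ->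
  (forall j, Ck k U (f j)) -> Ck k U (fun x => \sum_(j < n) f j x).
Proof.
move=> oU; elim: n f => [|n IH] f cf.
  apply: (@Ck_eq _ _ (fun=> 0)) => //; last exact: Ck_cst.
  by move=> x _; rewrite big_ord0.
apply: (@Ck_eq _ _ (fun x => f ord0 x + \sum_(j < n) f (lift ord0 j) x)) => //.
  by move=> x _; rewrite big_ord_recl.
by apply: Ck_add => //; exact: IH.
Qed.

Lemma is_derive_coord i j x : is_derive x (delta_mx 0 i)
  (fun y : 'rV[R]_d => y 0 j) (i == j)%:R.
Proof.
have hd : differentiable (fun y : 'rV[R]_d => y 0 j) x by exact: differentiable_coord.
apply: (is_derive_eq (derivableP (@diff_derivable _ _ _ _ _ (delta_mx 0 i) hd))).
have h : is_derive (0 : R) (1 : R) (fun k : R => k * (i == j)%:R + x 0 j)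
    ((1 * (i == j)%:R + 0 * 0) + 0).
  apply: (@is_derive_add _ _ (fun k : R => k * (i == j)%:R) (fun=> x 0 j)).
  exact: (@is_derive_mul _ _ (fun k : R => k) (fun=> (i == j)%:R)).
rewrite derive_line (_ : (fun k : R => _) = (fun k : R => k * (i == j)%:R + x 0 j)).
  by have [_ ->] := h; rewrite mul1r mulr0 !addr0.
by apply/funext => k; rewrite !mxE eqxx /= eq_sym.
Qed.

Lemma Ck_coord k U j : open U -> Ck k U (fun y : 'rV[R]_d => y 0 j).
Proof.
move=> oU; case: k => [|k].
  by split => // x _; exact: continuous_at_coord.
apply: (CkS_intro (df := fun i _ => (i == j)%:R)) => //.
- by move=> x _; exact: continuous_at_coord.
- by move=> i x Ux; exact: is_derive_coord.
- by move=> i; exact: Ck_cst.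
Qed.

(** The class of h' o f is an assumption rather than that of h', so that a family closed under
    derivation, such as [flat] or the real powers, feeds its own induction on k. *)
Lemma CkS_comp1 k U f (h h' : R -> R) : open U -> Ck k.+1 U f ->
  (forall x, U x -> is_derive (f x) (1 : R) h (h' (f x))) ->
  Ck k U (fun x => h' (f x)) -> Ck k.+1 U (fun x => h (f x)).
Proof.
move=> oU cf hh ch'.
have hdf i x : U x ->
    is_derive x (delta_mx 0 i) (fun y => h (f y)) (h' (f x) * partial i f x).
  by move=> Ux; apply: is_derive_comp1; [exact: hh|exact: (Ck_is_derive _ cf Ux)].
apply: (CkS_intro oU _ hdf).
- move=> x Ux; apply: (@continuous_comp _ _ _ f h); first exact: Ck_continuous cf Ux.
  have [dh _] := hh _ Ux.
  exact/differentiable_continuous/derivable1_diffP.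
- by move=> i; apply: Ck_mul => //; exact: Ck_partial.
Qed.

End Ck_calculus.

Lemma Ck_comp {R : realType} {m d : nat} k (U : set 'rV[R]_d) (V : set 'rV[R]_m)
    (F : 'rV[R]_m -> R) (c : 'rV[R]_d -> 'rV[R]_m) : open U -> open V ->
  (forall x, U x -> V (c x)) -> Ck k V F ->
  (forall j, Ck k U (fun x => c x 0 j)) -> Ck k U (fun x => F (c x)).
Proof.
move=> oU oV UV; elim: k F => [|k IH] F cF cc.
  split => // x Ux; apply: (@continuous_comp _ _ _ c F).
    by apply: continuous_at_rV => j; exact: Ck_continuous (cc j) Ux.
  exact: Ck_continuous cF (UV _ Ux).
have cc' j : Ck k U (fun x => c x 0 j) by exact: CkW (cc j).
apply: (CkS_intro (df := fun i x =>
  \sum_(j < m) partial j F (c x) * partial i (fun y => c y 0 j) x)) => //.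
- move=> x Ux; apply: (@continuous_comp _ _ _ c F).
    by apply: continuous_at_rV => j; exact: Ck_continuous (cc j) Ux.
  exact: Ck_continuous cF (UV _ Ux).
- move=> i x Ux; apply: is_derive_chain.
    exact: (Ck_differentiable oV cF (UV _ Ux)).
  by move=> j; exact: (Ck_is_derive _ (cc j) Ux).
- move=> i; apply: Ck_sum => // j; apply: Ck_mul => //.
    by apply: IH => //; exact: Ck_partial.
  exact: Ck_partial.
Qed.

(** * A smooth bump function and powers of the norm *)

Section flat_function.
Context {R : realType}.

(* The factor [t^-1 ^+ m] makes this family stable under derivation. *)
Definition flat (m : nat) (t : R) : R :=
  if 0 < t then t^-1 ^+ m * expR (- t^-1) else 0.

Lemma flat_ge0 m t : 0 <= flat m t.
Proof.
rewrite /flat; case: ltP => // t0.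
by rewrite mulr_ge0 ?expR_ge0// exprn_ge0// invr_ge0 ltW.
Qed.

Lemma flat_gt0 m t : 0 < t -> 0 < flat m t.
Proof.
by move=> t0; rewrite /flat t0 mulr_gt0 ?expR_gt0// exprn_gt0// invr_gt0.
Qed.

Lemma flat_eq0 m t : t <= 0 -> flat m t = 0.
Proof. by rewrite /flat ltNge => ->. Qed.

(** With x = 1/t, the term x^(m+1)/(m+1)! of the exponential series bounds exp x from below, which
    leaves one power of t to spare. *)
Lemma flat_le m t : flat m t <= (m.+1)`!%:R * `|t|.
Proof.
rewrite /flat; case: ltP => t0; last by rewrite mulr_ge0.
have s0 : 0 < t^-1 by rewrite invr_gt0.
rewrite (gtr0_norm t0) expRN ler_pdivrMr ?expR_gt0//.
have fp : 0 < (m.+1)`!%:R :> R by rewrite ltr0n fact_gt0.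
have h : t^-1 ^+ m.+1 / (m.+1)`!%:R <= expR t^-1.
  have := expR_ge1Dxn m (ltW s0); by apply: le_trans; rewrite lerDr.
rewrite ler_pdivrMr// in h.
rewrite -ler_pdivrMl ?mulr_gt0// invfM -mulrA.
rewrite mulrC ler_pdivrMr// (le_trans _ h)// exprS.
by rewrite mulrC.
Qed.

Lemma is_derive_flat m (t : R) :
  is_derive t (1 : R) (flat m) (- m%:R * flat m.+1 t + flat m.+2 t).
Proof.
have [t0|t0|->] := ltgtP t 0.
- rewrite !flat_eq0 ?(ltW t0)// mulr0 addr0.
  have : is_derive t (1 : R) (fun _ : R => 0 : R) 0 by exact: is_derive_cst.
  apply: near_eq_is_derive; have nt : \forall y \near t, y < 0 by exact: lt_nbhsl.
  by apply: filterS nt => y y0; rewrite flat_eq0 // ltW.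
- have hV : is_derive t (1 : R) (fun y : R => y^-1) (- (t^-1 ^+ 2)).
    have := @is_derive_invr R R id t 1 1 (lt0r_neq0 t0) (is_derive_id _ _).
    by rewrite mulr1.
  have hX : is_derive t^-1 (1 : R) (fun y : R => y ^+ m) (m%:R * t^-1 ^+ m.-1).
    have := derivableP (@exprn_derivable R m t^-1 1).
    by rewrite exp_derive /GRing.scale /= mulr1.
  have hN : is_derive t^-1 (1 : R) (fun y : R => - y) (- 1).
    by apply: is_derive_oppr; exact: is_derive_id.
  have hE : is_derive (- t^-1) (1 : R) expR (expR (- t^-1)) by exact: is_derive_expR.
  have := is_derive_comp1 (is_derive_mul hX (is_derive_comp1 hE hN)) hV.
  rewrite /flat t0 => h.
  have nt : \forall y \near t, 0 < y by exact: lt_nbhsr.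
  have : is_derive t (1 : R) (fun y : R => y^-1 ^+ m * expR (- y^-1))
    (- m%:R * (t^-1 ^+ m.+1 * expR (- t^-1)) + t^-1 ^+ m.+2 * expR (- t^-1)).
    apply: (is_derive_eq h); case: (m) => [|p]; rewrite /= ?exprS; ring.
  by apply: near_eq_is_derive; apply: filterS nt => y ->.
- rewrite !flat_eq0 // mulr0 addr0.
  have H : (fun h : R => h^-1 *: (flat m (h *: 1 + 0) - flat m 0)) @ 0^' --> (0 : R).
    apply/cvgrPdist_le => e e0 /=.
    have K0 : 0 < (m.+2)`!%:R :> R by rewrite ltr0n fact_gt0.
    near=> h.
    rewrite sub0r normrN (flat_eq0 m (lexx 0)) subr0 addr0 /GRing.scale /= mulr1.
    have hn0 : h != 0 by near: h; exact: nbhs_dnbhs_neq.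
    (* The difference quotient at 0 is [flat m.+1 h] for h > 0 and vanishes otherwise, so the linear
       bound [flat_le] makes it tend to 0. *)
    rewrite (@le_trans _ _ (flat m.+1 h))//.
      rewrite /flat; case: ifP => h0; last by rewrite mulr0 normr0.
      by rewrite exprS mulrA ger0_norm// !mulr_ge0 ?expR_ge0 ?exprn_ge0 ?invr_ge0 ?ltW.
    rewrite (le_trans (flat_le _ _))// -ler_pdivlMl//.
    by rewrite mulrC; near: h; apply: dnbhs0_le; rewrite divr_gt0.
  by apply: DeriveDef; [apply/cvg_ex; exists 0|exact: cvg_lim H].
Unshelve. all: by end_near. Qed.

Lemma continuous_flat m (t : R) : {for t, continuous (flat m)}.
Proof.
have [h _] := is_derive_flat m t.
exact/differentiable_continuous/derivable1_diffP.
Qed.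

Lemma Ck_flat d k m (U : set 'rV[R]_d) (q : 'rV[R]_d -> R) : open U ->
  Ck k U q -> Ck k U (fun x => flat m (q x)).
Proof.
move=> oU; elim: k m => [|k IH] m cq.
  split => // x Ux; apply: (@continuous_comp _ _ _ q (flat m)).
    exact: Ck_continuous cq Ux.
  exact: continuous_flat.
apply: (@CkS_comp1 _ _ _ _ _ _ (fun t => - m%:R * flat m.+1 t + flat m.+2 t)
  oU cq (fun x _ => is_derive_flat m (q x))).
have cq' : Ck k U q by exact: CkW cq.
suff : Ck k U (fun x => - m%:R * flat m.+1 (q x) + flat m.+2 (q x)) by [].
apply: Ck_add => //; last exact: IH.
by apply: Ck_mul; [|exact: Ck_cst|exact: IH].
Qed.

End flat_function.

Lemma powR_sub1 {R : realType} (x c : R) : 0 < x -> x `^ (c - 1) = x `^ c * x^-1.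
Proof.
by move=> x0; rewrite powRB ?powRr1 ?ltW//; apply/implyP => _; rewrite gt_eqF.
Qed.

Section powers.
Context {R : realType} {d : nat}.
Implicit Types (f : 'rV[R]_d -> R) (U : set 'rV[R]_d).

Lemma Ck_powR k U f (c : R) : open U -> (forall x, U x -> 0 < f x) ->
  Ck k U f -> Ck k U (fun x => f x `^ c).
Proof.
move=> oU f0; elim: k c => [|k IH] c cf.
  split => // x Ux; pose h t := t `^ c.
  change {for x, continuous (h \o f)}; apply: continuous_comp.
    exact: Ck_continuous cf Ux.
  have [dh _] := is_derive1_powR c (f0 _ Ux).
  exact/differentiable_continuous/derivable1_diffP.
apply: (@CkS_comp1 _ _ _ _ _ _ (fun t => c * t `^ (c - 1))
  oU cf (fun x Ux => is_derive1_powR c (f0 _ Ux))).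
suff : Ck k U (fun x => c * f x `^ (c - 1)) by [].
apply: Ck_mul; [by []|exact: Ck_cst|].
by apply: IH; exact: CkW cf.
Qed.

Lemma Ck_inv k U f : open U -> (forall x, U x -> 0 < f x) ->
  Ck k U f -> Ck k U (fun x => (f x)^-1).
Proof.
move=> oU f0 cf; apply: (@Ck_eq _ _ _ _ (fun x => f x `^ (-1))) => //.
  by move=> x /f0 /ltW ?; rewrite powR_inv1.
exact: Ck_powR.
Qed.

Lemma dotrv_ge0 (x : 'rV[R]_d) : 0 <= dotrv x x.
Proof. by apply: sumr_ge0 => i _; rewrite -expr2 sqr_ge0. Qed.

Lemma dotrv_gt0 (x : 'rV[R]_d) : x != 0 -> 0 < dotrv x x.
Proof.
move=> x0; rewrite lt_neqAle dotrv_ge0 andbT eq_sym.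
apply: contra x0 => /eqP s0; apply/eqP/rowP => i; rewrite mxE.
have /(_ i erefl)/eqP := psumr_eq0P (fun i _ => sqr_ge0 (x 0 i)) s0.
by rewrite sqrf_eq0 => /eqP.
Qed.

Lemma enorm_gt0 (x : 'rV[R]_d) : x != 0 -> 0 < enorm x.
Proof. by move=> x0; rewrite sqrtr_gt0 dotrv_gt0. Qed.

Lemma sqr_enorm (x : 'rV[R]_d) : enorm x ^+ 2 = dotrv x x.
Proof. by rewrite sqr_sqrtr// dotrv_ge0. Qed.

Lemma enormZ (r : R) (x : 'rV[R]_d) : 0 <= r -> enorm (r *: x) = r * enorm x.
Proof.
move=> r0; rewrite /enorm (_ : dotrv _ _ = r ^+ 2 * dotrv x x).
  by rewrite sqrtrM ?sqr_ge0// sqrtr_sqr ger0_norm.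
by rewrite /dotrv mulr_sumr; apply: eq_bigr => i _; rewrite !mxE; ring.
Qed.

Lemma open_punctured : open (@punctured R d).
Proof.
rewrite (_ : punctured = ~` [set 0]); last by apply/seteqP; split=> x /= /eqP.
apply: closed_openC; apply: accessible_closed_set1.
exact/hausdorff_accessible/norm_hausdorff.
Qed.

Lemma Ck_dotrv_self k U : open U -> Ck k U (fun x : 'rV[R]_d => dotrv x x).
Proof.
by move=> oU; apply: Ck_sum => // i; apply: Ck_mul => //; exact: Ck_coord.
Qed.

Lemma Ck_enorm k : Ck k punctured (@enorm R d).
Proof.
have oP := open_punctured.
apply: (@Ck_eq _ _ _ _ (fun x => dotrv x x `^ 2^-1)) => //.
  by move=> x _; rewrite powR12_sqrt// dotrv_ge0.
by apply: Ck_powR => //; [exact: dotrv_gt0|exact: Ck_dotrv_self].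
Qed.

Lemma Ck_enorm_powR k (c : R) : Ck k punctured (fun x : 'rV[R]_d => enorm x `^ c).
Proof.
by apply: Ck_powR; [exact: open_punctured|exact: enorm_gt0|exact: Ck_enorm].
Qed.

End powers.

(** * Integration on R^d *)

Section measurability.
Context {R : realType}.
Local Notation RT := (measurableTypeR R).

(* Countably many values, so that measurability is a matter of cells. *)
Definition grid_floor d (k : nat) (x : 'rV[R]_d) : 'rV[R]_d :=
  \row_i ((Num.floor (k.+1%:R * x 0 i))%:~R / k.+1%:R).

Lemma grid_floor_dist d k (x : 'rV[R]_d) : `|x - grid_floor k x| <= k.+1%:R^-1.
Proof.
apply: normr_rV_le; first by rewrite invr_ge0.
move=> i; rewrite !mxE.
have k0 : 0 < k.+1%:R :> R by rewrite ltr0n.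
set z := Num.floor _.
have /andP[z1 z2] : z%:~R <= k.+1%:R * x 0 i < (z + 1)%:~R.
  exact: floor_itv.
rewrite intrD in z2.
rewrite ger0_norm; last by rewrite subr_ge0 ler_pdivrMr// mulrC.
rewrite lerBlDr -[X in _ <= X + _]mul1r -mulrDl ler_pdivlMr// mulrC.
by rewrite addrC ltW.
Qed.

Lemma measurable_grid_floor d k (g : 'rV[R]_d -> R) :
  measurable_fun setT (fun t : d.-tuple RT => g (grid_floor k (vec t)) : RT).
Proof.
move=> _ Y mY; rewrite setTI.
pose pt (z : d.-tuple int) : 'rV[R]_d := \row_i ((tnth z i)%:~R / k.+1%:R).
pose cell (z : d.-tuple int) : set (d.-tuple RT) :=
  \bigcap_(i in [set: 'I_d])
    [set t | Num.floor (k.+1%:R * (tnth t i : R)) = tnth z i].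
rewrite (_ : _ @^-1` _ = \bigcup_(z : d.-tuple int)
    (if `[< Y (g (pt z)) >] then cell z else set0)); last first.
apply/seteqP; split => t /=.
- move=> Yt; exists [tuple Num.floor (k.+1%:R * (tnth t i : R)) | i < d] => //.
  set z := [tuple _ | _ < _].
  have e : pt z = grid_floor k (vec t).
    by apply/rowP => i; rewrite !mxE tnth_mktuple.
  by rewrite asboolT ?e// => i _ /=; rewrite tnth_mktuple.
- move=> [z _]; case: ifPn => // /asboolP Yz tz.
  rewrite (_ : grid_floor _ _ = pt z)//.
  by apply/rowP => i; rewrite !mxE (tz i).
apply: countable_bigcupT_measurable => // z.
case: ifPn => // _; apply: fin_bigcap_measurable => // i _.
rewrite (_ : [set t | _] = (fun t : d.-tuple RT => k.+1%:R * (tnth t i : R) : RT)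
    @^-1` `[(tnth z i)%:~R, (tnth z i + 1)%:~R[); last first.
  apply/seteqP; split => t /=; rewrite in_itv /=.
    by move=> <-; exact: floor_itv.
  exact: floor_def.
rewrite -[X in measurable X]setTI.
have mf : measurable_fun setT (fun t : d.-tuple RT => k.+1%:R * (tnth t i : R) : RT).
  apply: measurable_funM => //. exact: (@measurable_tnth _ RT d i).
by apply: mf.
Qed.

(** Measurability refers to the product sigma-algebra on tuples. A continuous g is the pointwise
    limit of its values at the grid points [grid_floor k], and these are measurable by inspection of
    cells. *)
Lemma measurable_continuous_vec d (g : 'rV[R]_d -> R) :
  (forall x, {for x, continuous g}) ->
  measurable_fun setT (fun t : d.-tuple RT => g (vec t) : RT).
Proof.
move=> cg.
apply: (measurable_fun_cvg (h := fun k (t : d.-tuple RT) => g (grid_floor k (vec t)) : RT)).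
  by move=> k; exact: measurable_grid_floor.
move=> t _; apply: (@cvg_comp _ _ _ (fun k => grid_floor k (vec t)) g _
  (nbhs (vec t))); last exact: cg.
apply/cvgrPdist_le => e e0; near=> k.
rewrite (le_trans (grid_floor_dist _ _))//.
apply: ltW; near: k; exact: (near_infty_natSinv_lt (PosNum e0)).
Unshelve. all: by end_near. Qed.

End measurability.

(** * Cubes, and integrability of continuous functions with compact support *)

Section boxes.
Context {R : realType}.
Local Notation RT := (measurableTypeR R).

Lemma tnth_consT0 n (q : RT * n.-tuple RT) : tnth (consT q) ord0 = q.1.
Proof. by rewrite (tnth_nth q.1). Qed.

Lemma tnth_consTS n (q : RT * n.-tuple RT) i :
  tnth (consT q) (lift ord0 i) = tnth q.2 i.
Proof. by rewrite !(tnth_nth q.1). Qed.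

Definition box d (c : 'I_d -> R) (e : R) : set (d.-tuple RT) :=
  [set t | forall i, `[c i - e, c i + e]%classic (tnth t i : R)].

Lemma measurable_box d (c : 'I_d -> R) e : measurable (box c e).
Proof.
rewrite (_ : box c e = \bigcap_(i in [set: 'I_d])
    ((fun t : d.-tuple RT => tnth t i) @^-1` `[c i - e, c i + e])); last first.
  by apply/seteqP; split => t /= H i //; [move=> _; exact: H|exact: (H i I)].
apply: fin_bigcap_measurable => // i _.
rewrite -[X in measurable X]setTI.
by apply: (@measurable_tnth _ RT d i).
Qed.

(** Pulled back by [consT], a cube is a segment times a cube of lower dimension. In dimension 0 the
    measure is a Dirac mass, which matches the empty product 1. *)
Lemma leb_box d (c : 'I_d -> R) (e : R) : 0 < e ->
  leb d (box c e) = ((2 * e) ^+ d)%:E.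
Proof.
move=> e0; elim: d c => [|d IH] c.
  rewrite /= diracE mem_set// => i; by case: i.
rewrite /= /cons_measure /pushforward.
rewrite (_ : _ @^-1` _ = `[c ord0 - e, c ord0 + e]%classic `*`
    box (fun i => c (lift ord0 i)) e); last first.
  apply/seteqP; split => -[x t] /=.
    move=> H; split; first by have := H ord0; rewrite tnth_consT0.
    by move=> i; have := H (lift ord0 i); rewrite tnth_consTS.
  move=> [H1 H2] i; have [->|] := eqVneq i ord0; first by rewrite tnth_consT0.
  by rewrite eq_sym => /unlift_some[j -> _]; rewrite tnth_consTS; exact: H2.
rewrite product_measure1E//=; last exact: measurable_box.
rewrite IH lebesgue_measure_itv /= lte_fin ifT; last by lra.
rewrite -EFinB -EFinM exprS; congr (_ %:E); ring.
Qed.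

(** Vanishing outside a ball is the form of compact support that passes at once to slices of a
    function and to its partial derivatives. *)
Definition compactly_supported d (g : 'rV[R]_d -> R) :=
  exists M : R, forall x, M < `|x| -> g x = 0.

Lemma continuous_compact_bounded d (g : 'rV[R]_d -> R) :
  (forall x, {for x, continuous g}) -> compactly_supported g ->
  exists N : R, forall x, `|g x| <= N.
Proof.
move=> cg [M hM].
have cK : compact [set x : 'rV[R]_d | forall i, `[- M, M]%classic (x ord0 i)].
  by apply: (@rV_compact _ _ (fun=> `[- M, M]%classic)) => i; exact: segment_compact.
have /compact_bounded[N [_ HN]] := continuous_compact (continuous_subspaceT cg) cK.
exists (`|N| + 1) => x; have N1 : N < `|N| + 1.
  by rewrite (le_lt_trans (ler_norm N))// ltrDl.
have [xM|/hM->] := leP `|x| M; last by rewrite normr0 addr_ge0.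
apply: (HN _ N1); exists x => // i /=.
by rewrite in_itv /= -ler_norml (le_trans (normr_coord _ _)).
Qed.

Lemma integrable_compactly_supported d (g : 'rV[R]_d -> R) :
  (forall x, {for x, continuous g}) -> compactly_supported g ->
  (leb d).-integrable setT (fun t => (g (vec t))%:E).
Proof.
move=> cg sg; have [N hN] := continuous_compact_bounded cg sg.
have [M hM] := sg.
pose B := @box d (fun=> 0) (`|M| + 1).
have mB : measurable B by exact: measurable_box.
have e0 : 0 < `|M| + 1 :> R by rewrite ltr_wpDl.
have mg := measurable_continuous_vec cg.
have fB : (leb d B < +oo)%E by rewrite /B leb_box// ltry.
have : (leb d).-integrable B (EFin \o (fun t => g (vec t))).
  apply: measurable_bounded_integrable => //.
  - exact: measurable_funTS.
  - exists N; split=> [|K NK t _] /=; first exact: num_real.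
    by rewrite (le_trans (hN _))// ltW.
rewrite integrable_mkcond//; apply: eq_integrable => // t _.
rewrite patchE; case: ifPn => // /negP tB; congr (_%:E); apply/esym/hM.
rewrite ltNge; apply/negP => tM; apply: tB; rewrite inE => i /=.
rewrite in_itv /= sub0r add0r -ler_norml.
have := normr_coord (vec t) i; rewrite mxE => /le_trans; apply.
by rewrite (le_trans tM)// (le_trans (ler_norm _))// lerDl.
Qed.

End boxes.

(** * Vanishing of the integral of a partial derivative *)

Section integration_by_parts.
Context {R : realType}.
Local Notation RT := (measurableTypeR R).

(** Counterpart on row vectors of [consT], through which [leb] is built; it isolates the first
    variable for Fubini's theorem. *)
Definition row_cons d (s : R) (y : 'rV[R]_d) : 'rV[R]_d.+1 :=
  \row_i oapp (fun j => y 0 j) s (unlift ord0 i).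

Lemma row_cons0 d s (y : 'rV[R]_d) : row_cons s y 0 0 = s.
Proof. by rewrite mxE unlift_none. Qed.

Lemma row_consS d s (y : 'rV[R]_d) j : row_cons s y 0 (lift ord0 j) = y 0 j.
Proof. by rewrite mxE liftK. Qed.

Lemma row_cons_addl d s h (y : 'rV[R]_d) :
  row_cons (h * 1 + s) y = h *: delta_mx 0 ord0 + row_cons s y.
Proof.
apply/rowP => i; have [->|] := eqVneq i ord0.
  by rewrite row_cons0 2!mxE row_cons0 !mxE !eqxx.
rewrite eq_sym => /unlift_some[j -> _].
by rewrite row_consS 2!mxE row_consS !mxE eqxx /= mulr0 add0r.
Qed.

Lemma row_cons_addr d s h (y : 'rV[R]_d) j :
  row_cons s (h *: delta_mx 0 j + y) =
  h *: delta_mx 0 (lift ord0 j) + row_cons s y.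
Proof.
apply/rowP => i; have [->|] := eqVneq i ord0.
  by rewrite row_cons0 2!mxE row_cons0 !mxE !eqxx /= mulr0 add0r.
rewrite eq_sym => /unlift_some[k -> _].
by rewrite row_consS 2!mxE [in RHS]mxE row_consS !mxE (inj_eq lift_inj).
Qed.

Lemma continuous_row_consl d (y : 'rV[R]_d) (s : R) :
  {for s, continuous (fun s => row_cons s y)}.
Proof.
apply: continuous_at_rV => i; have [->|] := eqVneq i ord0.
  rewrite (_ : (fun s => _) = id); first exact: cvg_id.
  by apply/funext => t; rewrite row_cons0.
rewrite eq_sym => /unlift_some[k -> _].
rewrite (_ : (fun s => _) = cst (y 0 k)); first exact: continuous_at_cst.
by apply/funext => t; rewrite row_consS.
Qed.

Lemma continuous_row_consr d (y : 'rV[R]_d) (s : R) :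
  {for y, continuous (row_cons s)}.
Proof.
apply: continuous_at_rV => i; have [->|] := eqVneq i ord0.
  rewrite (_ : (fun z => _) = cst s); first exact: continuous_at_cst.
  by apply/funext => t; rewrite row_cons0.
rewrite eq_sym => /unlift_some[k -> _].
rewrite (_ : (fun z => _) = (fun z : 'rV[R]_d => z 0 k)).
  exact: continuous_at_coord.
by apply/funext => t; rewrite row_consS.
Qed.

Lemma normr_row_cons d s (y : 'rV[R]_d) :
  `|s| <= `|row_cons s y| /\ `|y| <= `|row_cons s y|.
Proof.
split; first by rewrite -[in leLHS](row_cons0 s y) normr_coord.
by apply: normr_rV_le => // i; rewrite -(row_consS s y) normr_coord.
Qed.

Lemma vec_consT d (q : RT * d.-tuple RT) : vec (consT q) = row_cons q.1 (vec q.2).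
Proof.
apply/rowP => i; have [->|] := eqVneq i ord0.
  by rewrite row_cons0 mxE tnth_consT0.
rewrite eq_sym => /unlift_some[k -> _].
by rewrite row_consS !mxE tnth_consTS.
Qed.

Lemma compactly_supported_partial d (f : 'rV[R]_d -> R) i :
  compactly_supported f -> compactly_supported (partial i f).
Proof.
move=> [M hM]; exists M => x xM.
have oU : open [set y : 'rV[R]_d | M < `|y|].
  have := @open_comp _ _ (@Num.norm R 'rV[R]_d) [set r | M < r].
  apply; last exact: open_gt.
  by move=> y _; exact: norm_continuous.
rewrite (@partial_eq _ _ _ _ (fun=> 0) _ i oU hM xM).
exact: derive_cst.
Qed.

(** Fundamental theorem of calculus on [-N, N], with N larger than M so that f vanishes at both
    ends. *)
Lemma integral_derive_compactly_supported (f f' : R -> R) (M : R) :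
  (forall s : R, is_derive s (1 : R) f (f' s)) ->
  (forall s : R, {for s, continuous f'}) ->
  (forall s, M < `|s| -> f s = 0) -> (forall s, M < `|s| -> f' s = 0) ->
  (\int[@lebesgue_measure R]_s (f' s)%:E = 0)%E.
Proof.
move=> hf cf' f0 f'0.
pose N : R := `|M| + 1.
have N0 : 0 < N by rewrite ltr_wpDl.
have MN : M < N by rewrite (le_lt_trans (ler_norm M))// ltrDl.
have cf (s : R) : {for s, continuous f}.
  have [df _] := hf s; exact/differentiable_continuous/derivable1_diffP.
transitivity (\int[@lebesgue_measure R]_(s in `[(- N)%R, N]) (f' s)%:E)%E.
  rewrite [RHS]integral_mkcond; apply: eq_integral => s _.
  rewrite patchE; case: ifPn => // /negP sN; rewrite f'0//.
  rewrite (lt_trans MN)// ltNge ler_norml; apply/negP => sN'.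
  by apply: sN; rewrite inE /= in_itv.
rewrite (@continuous_FTC2 R f' f (- N) N).
- rewrite !f0 ?subee// ?normrN (gtr0_norm N0)//.
- by lra.
- exact: continuous_subspaceT.
- split.
  + by move=> s _; have [] := hf s.
  + by apply: cvg_at_right_filter; exact: cf.
  + by apply: cvg_at_left_filter; exact: cf.
- by move=> s _; rewrite derive1E; have [_ ->] := hf s.
Qed.

Lemma ge0_integral_lebS d (h : d.+1.-tuple RT -> \bar R) :
  measurable_fun setT h -> (forall t, 0 <= h t)%E ->
  (\int[leb d.+1]_t h t = \int[@lebesgue_measure R \x leb d]_q h (consT q))%E.
Proof.
move=> mh h0.
have := @ge0_integral_pushforward _ _ _ _ R (@consT R d)
  (@measurable_consT R d) (@lebesgue_measure R \x leb d)%E setT h measurableT.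
rewrite preimage_setT; apply; first exact: mh.
by move=> t _; exact: h0.
Qed.

(** Change of variables for the pushforward by [consT]. Integrability of the composite comes from
    the nonnegative case applied to the absolute value. *)
Lemma integral_lebS d (h : d.+1.-tuple RT -> \bar R) :
  (leb d.+1).-integrable setT h ->
  (@lebesgue_measure R \x leb d)%E.-integrable setT (h \o @consT R d) /\
  (\int[leb d.+1]_t h t = \int[@lebesgue_measure R \x leb d]_q h (consT q))%E.
Proof.
move=> ih; have /integrableP[mh hoo] := ih.
have ih' : (@lebesgue_measure R \x leb d)%E.-integrable setT (h \o @consT R d).
  apply/integrableP; split; first exact: measurableT_comp (@measurable_consT R d).
  rewrite -(@ge0_integral_lebS d (abse \o h)) => [//| |t]; last exact: abse_ge0.
  exact: measurableT_comp.
split => //.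
have := @integral_pushforward _ _ _ _ R (@consT R d)
  (@measurable_consT R d) (@lebesgue_measure R \x leb d)%E setT h mh.
by rewrite preimage_setT; apply.
Qed.

(** Induction on d with Fubini's theorem, the order of integration depending on i. For the first
    coordinate, the inner integral over that variable vanishes by the fundamental theorem of
    calculus; for another one, the inner integral over the remaining variables vanishes by the
    induction hypothesis applied to the slice. *)
Lemma integral_partial d (f : 'rV[R]_d -> R) i :
  Ck 1 setT f -> compactly_supported f ->
  (\int[leb d]_t (partial i f (vec t))%:E = 0)%E.
Proof.
elim: d f i => [|d IH] f i cf sf; first by case: i.
have cp x : {for x, continuous (partial i f)}.
  exact: (Ck_continuous (Ck_partial i cf)).
have sp := compactly_supported_partial i sf.
have ip := integrable_compactly_supported cp sp.
pose F (q : RT * d.-tuple RT) := (partial i f (row_cons q.1 (vec q.2)))%:E.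
have [iF ->] := integral_lebS ip.
have FE q : (partial i f (vec (consT q)))%:E = F q by rewrite vec_consT.
have {}iF : (@lebesgue_measure R \x leb d)%E.-integrable setT F.
  by apply: eq_integrable iF => // q _; exact: FE.
under eq_integral do rewrite FE.
have [i0|] := eqVneq i ord0.
  rewrite -integral21_prod_meas1//; apply: integral0_eq => t _.
  rewrite /fubini_G /F /=.
  have [M hM] := sf; have [M' hM'] := sp.
  pose g (s : R) := f (row_cons s (vec t)).
  apply: (@integral_derive_compactly_supported g _ (Num.max M M')).
  - move=> s; have [+ _] := Ck_is_derive i cf (I : setT (row_cons s (vec t))).
    move=> /derivable_line; rewrite i0 /partial derive_line.
    have -> : (fun h : R => f (h *: delta_mx 0 ord0 + row_cons s (vec t))) =
        (fun h : R => g (h *: (1 : R) + s)).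
      by apply/funext => h; rewrite -row_cons_addl.
    by move=> /line_derivable dg; apply: DeriveDef => //; rewrite derive_line.
  - move=> s; apply: (@continuous_comp _ _ _ (fun s => row_cons s (vec t)) (partial i f)).
      exact: continuous_row_consl.
    exact: cp.
  - move=> s; rewrite gt_max => /andP[sM _]; apply: hM.
    exact: lt_le_trans sM (normr_row_cons _ _).1.
  - move=> s; rewrite gt_max => /andP[_ sM]; apply: hM'.
    exact: lt_le_trans sM (normr_row_cons _ _).1.
rewrite eq_sym => /unlift_some[j ij _].
rewrite -integral12_prod_meas1//; apply: integral0_eq => s _.
rewrite /fubini_F /F /=.
pose g (y : 'rV[R]_d) := f (row_cons s y).
have hg k y : is_derive y (delta_mx 0 k) g (partial (lift ord0 k) f (row_cons s y)).
  have [+ _] := Ck_is_derive (lift ord0 k) cf (I : setT (row_cons s y)).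
  move=> /derivable_line; rewrite /partial derive_line.
  have -> : (fun h : R => f (h *: delta_mx 0 (lift ord0 k) + row_cons s y)) =
      (fun h : R => g (h *: delta_mx 0 k + y)).
    by apply/funext => h; rewrite -row_cons_addr.
  by move=> /line_derivable dg; apply: DeriveDef => //; rewrite derive_line.
have -> : (fun t => (partial i f (row_cons s (vec t)))%:E) =
          (fun t => (partial j g (vec t))%:E).
  apply/funext => t; congr (_%:E); rewrite ij.
  by have [_ <-] := hg j (vec t).
apply: IH.
  apply: (@CkS_intro _ _ _ _ _ (fun k y => partial (lift ord0 k) f (row_cons s y))).
  - exact: openT.
  - move=> y _; apply: (@continuous_comp _ _ _ (row_cons s) f).
      exact: continuous_row_consr.
    exact: (Ck_continuous cf).
  - move=> k; split=> // y _.
    apply: (@continuous_comp _ _ _ (row_cons s) (partial (lift ord0 k) f)).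
      exact: continuous_row_consr.
    exact: (Ck_continuous (Ck_partial _ cf)).
have [M hM] := sf; exists M => y yM; apply: hM.
exact: lt_le_trans yM (normr_row_cons _ _).2.
Qed.

End integration_by_parts.

(** * From weak to pointwise solutions *)

Section weak_to_strong.
Context {R : realType} {d : nat}.
Local Notation RT := (measurableTypeR R).
Implicit Types (f g h phi psi : 'rV[R]_d -> R) (U K : set 'rV[R]_d).

Lemma compact_supported K psi : compact K -> (forall x, ~ K x -> psi x = 0) ->
  compactly_supported psi.
Proof.
move=> /compact_bounded[N [_ HN]] h0; exists (`|N| + 1) => x xN; apply: h0 => Kx.
have N1 : N < `|N| + 1 by rewrite (le_lt_trans (ler_norm N))// ltrDl.
by have := HN _ N1 _ Kx; rewrite /= leNgt xN.
Qed.

Lemma open_compactC K : compact K -> open (~` K).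
Proof.
by move=> cK; apply: closed_openC; apply: compact_closed => //; exact: norm_hausdorff.
Qed.

Lemma partial_off_support K psi i x : compact K ->
  (forall x, ~ K x -> psi x = 0) -> ~ K x -> partial i psi x = 0.
Proof.
move=> cK h0 Kx; rewrite (@partial_eq _ _ (~` K) psi (fun=> 0) x i)//.
  exact: derive_cst.
exact: open_compactC.
Qed.

(** Extension by zero: U and the complement of K are open and cover the space, and the product is of
    class C^k on each. Thus f may be singular outside U, as powers of |x| are at the origin. *)
Lemma Ck_mul_supported k U K f psi : open U -> compact K -> K `<=` U ->
  (forall x, ~ K x -> psi x = 0) -> Ck k U f -> Ck k setT psi ->
  Ck k setT (fun x => f x * psi x).
Proof.
move=> oU cK KU h0 cf cpsi.
have -> : [set: 'rV[R]_d] = U `|` ~` K.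
  by apply/seteqP; split => // x _; have [/KU|] := pselect (K x); [left|right].
have oK := open_compactC cK.
apply: Ck_setU.
  by apply: Ck_mul => //; apply: Ck_subset cpsi.
apply: (@Ck_eq _ _ _ _ (fun=> 0)) => //; last exact: Ck_cst.
by move=> x /h0 ->; rewrite mulr0.
Qed.

Lemma integrable_mul_supported U K f psi : open U -> compact K -> K `<=` U ->
  (forall x, ~ K x -> psi x = 0) -> Ck 0 U f -> Ck 0 setT psi ->
  (leb d).-integrable setT (fun t => (f (vec t) * psi (vec t))%:E).
Proof.
move=> oU cK KU h0 cf cpsi.
have c0 := Ck_mul_supported oU cK KU h0 cf cpsi.
apply: (@integrable_compactly_supported _ _ (fun x => f x * psi x)).
  by move=> x; exact: (Ck_continuous c0).
by apply: (compact_supported cK) => x /h0 ->; rewrite mulr0.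
Qed.

(** Both conclusions are proved together: additivity at each step of the induction calls for
    integrability of the remaining sum. *)
Lemma intRd_sum n (F : 'I_n -> 'rV[R]_d -> R) :
  (forall i, (leb d).-integrable setT (fun t => (F i (vec t))%:E)) ->
  intRd (fun x => \sum_(i < n) F i x) = \sum_(i < n) intRd (F i) /\
  (leb d).-integrable setT (fun t => (\sum_(i < n) F i (vec t))%:E).
Proof.
elim: n F => [|n IH] F hF.
  rewrite big_ord0; split.
    rewrite /intRd; under eq_Rintegral do rewrite big_ord0.
    by rewrite /Rintegral integral0.
  by under eq_fun do rewrite big_ord0; exact: integrable0.
have [IH1 IH2] := IH (fun i => F (lift ord0 i)) (fun i => hF _).
split.
  rewrite big_ord_recl -IH1 /intRd.
  under eq_Rintegral do rewrite big_ord_recl.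
  by apply: RintegralD; [exact: measurableT|exact: hF|exact: IH2].
under eq_fun do rewrite big_ord_recl EFinD.
by apply: integrableD; [exact: measurableT|exact: hF|exact: IH2].
Qed.

(** Outside K every term carries a vanishing factor, so the Leibniz rule survives at points where f
    has no derivative. *)
Lemma partial_mul_supported U K f psi i x : open U -> compact K -> K `<=` U ->
  (forall x, ~ K x -> psi x = 0) -> Ck 1 U f -> Ck 1 setT psi ->
  partial i (fun x => f x * psi x) x = partial i f x * psi x + f x * partial i psi x.
Proof.
move=> oU cK KU h0 cf cpsi.
have [/KU Ux|Kx] := pselect (K x).
  have := is_derive_mul (Ck_is_derive i cf Ux) (Ck_is_derive i cpsi I).
  by move=> [_ <-].
rewrite (h0 _ Kx) (partial_off_support _ cK h0 Kx) !mulr0 addr0.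
by apply: (partial_off_support _ cK) => // y /h0 ->; rewrite mulr0.
Qed.

Lemma intRd_by_parts U K f psi i : open U -> compact K -> K `<=` U ->
  (forall x, ~ K x -> psi x = 0) -> Ck 1 U f -> Ck 1 setT psi ->
  intRd (fun x => partial i f x * psi x) = - intRd (fun x => f x * partial i psi x).
Proof.
move=> oU cK KU h0 cf cpsi; apply/eqP; rewrite -addr_eq0; apply/eqP.
have h0' x : ~ K x -> partial i psi x = 0 by move=> Kx; exact: (partial_off_support i cK h0 Kx).
rewrite /intRd -RintegralD//.
- have E x := @partial_mul_supported U K f psi i x oU cK KU h0 cf cpsi.
  under eq_Rintegral do rewrite -E.
  rewrite /Rintegral integral_partial//; first exact: (Ck_mul_supported oU cK KU h0 cf cpsi).
  by apply: (compact_supported cK) => x /h0 ->; rewrite mulr0.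
- apply: (integrable_mul_supported oU cK KU h0); first exact: Ck_partial cf.
  exact: CkW cpsi.
- apply: (integrable_mul_supported oU cK KU h0'); first exact: CkW cf.
  exact: Ck_partial cpsi.
Qed.

(** The argument of [flat] is e^2 minus the squared Euclidean distance to c, a polynomial, so
    smoothness holds also at c. *)
Definition bump (c : 'rV[R]_d) (e : R) : 'rV[R]_d -> R :=
  fun x => flat 0 (e ^+ 2 - \sum_(i < d) (x 0 i - c 0 i) * (x 0 i - c 0 i)).

Lemma bump_eq0 (c : 'rV[R]_d) (e : R) (x : 'rV[R]_d) : 0 < e ->
  ~ `|x - c| <= e -> bump c e x = 0.
Proof.
move=> e0 H; apply: flat_eq0; rewrite leNgt; apply/negP => s0; apply: H.
have {}s0 : \sum_(i < d) (x 0 i - c 0 i) * (x 0 i - c 0 i) < e ^+ 2 by lra.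
apply: normr_rV_le; first exact: ltW.
move=> i; rewrite !mxE -ler_sqr ?nnegrE ?normr_ge0 ?(ltW e0)// real_normK ?num_real//.
apply: ltW; apply: le_lt_trans s0; rewrite (bigD1 i)//= -expr2 lerDl.
by apply: sumr_ge0 => j _; rewrite -expr2 sqr_ge0.
Qed.

Lemma bump_gt0 (c : 'rV[R]_d) (e : R) : 0 < e -> 0 < bump c e c.
Proof.
move=> e0; apply: flat_gt0; rewrite big1 ?subr0 ?exprn_gt0// => i _.
by rewrite subrr mulr0.
Qed.

Lemma bump_test U (c : 'rV[R]_d) (e : R) : 0 < e ->
  (forall x : 'rV[R]_d, `|x - c| <= e -> U x) -> test_function U (bump c e).
Proof.
move=> e0 hU; split.
  move=> k; apply: Ck_flat; first exact: openT.
  apply: Ck_sub; [exact: openT|apply: Ck_cst; exact: openT|].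
  apply: Ck_sum => [|i]; first exact: openT.
  have H : Ck k setT (fun x : 'rV[R]_d => x 0 i - c 0 i).
    by apply: Ck_sub; [exact: openT|apply: Ck_coord; exact: openT|apply: Ck_cst; exact: openT].
  by apply: Ck_mul => //; exact: openT.
have KE (x : 'rV[R]_d) : (forall i, `[c ord0 i - e, c ord0 i + e]%classic (x ord0 i)) <->
    `|x - c| <= e.
  split=> [H|H i /=].
    apply: normr_rV_le; first exact: ltW.
    by move=> i; have := H i; rewrite /= in_itv /= !mxE ler_distl.
  rewrite in_itv /= -ler_distl; apply: le_trans H.
  by have := normr_coord (x - c) i; rewrite !mxE.
(* The closed sup-norm ball, compact as a product of segments, contains the Euclidean ball on which
   the bump is positive. *)
exists [set x : 'rV[R]_d | forall i, `[c ord0 i - e, c ord0 i + e]%classic (x ord0 i)].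
  split.
    apply: (@rV_compact _ _ (fun i => `[c ord0 i - e, c ord0 i + e]%classic)) => i.
    exact: segment_compact.
  by move=> x /KE; exact: hU.
by move=> x H; apply: bump_eq0 => // /KE.
Qed.

Lemma near_norm_le (x : 'rV[R]_d) (P : 'rV[R]_d -> Prop) :
  (\forall y \near x, P y) ->
  exists2 e : R, 0 < e & forall y : 'rV[R]_d, `|y - x| <= e -> P y.
Proof.
move=> /nbhs_ballP[e e0 H]; exists (e / 2); first by rewrite divr_gt0.
move=> y yx; apply: H; rewrite -ball_normE /= distrC (le_lt_trans yx)//.
by have : 0 < e by []; lra.
Qed.

(** If h were positive at x, a bump concentrated where h stays above half of h x would give a
    positive integral. *)
Lemma fundamental_lemma_gt0 U h (x : 'rV[R]_d) : open U -> Ck 0 U h -> U x ->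
  (forall phi, test_function U phi -> intRd (fun x => h x * phi x) = 0) ->
  ~ 0 < h x.
Proof.
move=> oU ch Ux H hx0.
have near_half g : {for x, continuous g} -> 0 < g x ->
    \forall y \near x, g x / 2 <= g y.
  move=> cg gx0; have g2 : 0 < g x / 2 by rewrite divr_gt0.
  have /cvgrPdist_le/(_ _ g2) := cg; apply: filterS => y.
  by rewrite ler_distl => /andP[]; lra.
have [e e0 he] : exists2 e : R, 0 < e &
    forall y : 'rV[R]_d, `|y - x| <= e -> U y /\ h x / 2 <= h y.
  apply: near_norm_le; have nU : \forall y \near x, U y by apply: open_nbhs_nbhs.
  have := near_half h (Ck_continuous ch Ux) hx0.
  by apply: filterS2 nU => y; split.
have tb : test_function U (bump x e).
  by apply: bump_test => // y /he[].
have [_ [K [cK KU] K0]] := tb.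
have cb : Ck 0 setT (bump x e) by exact: tb.1.
have bx : 0 < h x * bump x e x by rewrite mulr_gt0// bump_gt0.
have hb0 y : 0 <= h y * bump x e y.
  have [/he[_ hy]|ye] := pselect (`|y - x| <= e); last by rewrite bump_eq0// mulr0.
  by rewrite mulr_ge0 ?flat_ge0//; lra.
have chb := Ck_mul_supported oU cK KU K0 ch cb.
(* A second radius: on the first ball the product is only nonnegative, since the bump vanishes at
   its edge; near x it stays above half of its value at x. *)
have [e' e'0 he'] : exists2 e' : R, 0 < e' & forall y : 'rV[R]_d,
    `|y - x| <= e' -> h x * bump x e x / 2 <= h y * bump x e y.
  apply: near_norm_le.
  exact: (near_half (fun y => h y * bump x e y) (Ck_continuous chb I) bx).
have := H _ tb.
have ih := integrable_mul_supported oU cK KU K0 ch cb.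
apply/eqP; rewrite gt_eqF//.
(* The real integral is the finite part of an extended one, which is 0 at infinity; strict
   positivity therefore also asks for finiteness. *)
rewrite /intRd /Rintegral fine_gt0//; apply/andP; split; last first.
  have /integrableP[_] := ih; apply: le_lt_trans.
  rewrite le_eqVlt; apply/orP; left; apply/eqP; apply: eq_integral => t _.
  by rewrite gee0_abs// lee_fin hb0.
pose B := box (fun i => x 0 i) e' : set (d.-tuple RT).
have mB : measurable B by exact: measurable_box.
have mhb := measurable_continuous_vec (fun y => Ck_continuous chb (I : setT y)).
(* Lower bound by a positive constant times the measure of a cube. *)
apply: (@lt_le_trans _ _ (\int[leb d]_(t in B) (cst (h x * bump x e x / 2)%:E t))%E).
  by rewrite integral_cst//= /B leb_box// -EFinM lte_fin; apply: mulr_gt0;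
    [rewrite divr_gt0|rewrite exprn_gt0// mulr_gt0].
apply: (@le_trans _ _ (\int[leb d]_(t in B) (h (vec t) * bump x e (vec t))%:E)%E).
  apply: ge0_le_integral => //=.
  - by move=> t _; rewrite lee_fin divr_ge0// ltW.
  - by apply/measurable_EFinP; exact: measurable_funTS.
  - move=> t tB; rewrite lee_fin; apply: he'; apply: normr_rV_le; first exact: ltW.
    by move=> i; have := tB i; rewrite /= in_itv /= !mxE ler_distl.
apply: ge0_subset_integral => //.
  exact/measurable_EFinP.
by move=> t _; rewrite lee_fin hb0.
Qed.

Lemma fundamental_lemma U h (x : 'rV[R]_d) : open U -> Ck 0 U h -> U x ->
  (forall phi, test_function U phi -> intRd (fun x => h x * phi x) = 0) ->
  h x = 0.
Proof.
move=> oU ch Ux H; apply/eqP; rewrite eq_le !leNgt; apply/andP; split; apply/negP.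
  exact: fundamental_lemma_gt0 H.
rewrite -oppr_gt0; apply: (@fundamental_lemma_gt0 U (fun y => - h y)) => //.
  exact: Ck_opp.
move=> phi tphi; rewrite /intRd.
have [_ [K [cK KU] K0]] := tphi.
have := RintegralZl (-1) measurableT (integrable_mul_supported oU cK KU K0 ch (tphi.1 0%N)).
rewrite -/(intRd (fun y => h y * phi y)) (H _ tphi) mulr0 => <-.
by apply: eq_Rintegral => t _; rewrite mulN1r mulNr.
Qed.

(** Since psi vanishes off K, the product equals the truncation of g to K times psi, an integrable
    function times a bounded one. *)
Lemma Lloc_integrable_mul (K : set 'rV[R]_d) (g psi : 'rV[R]_d -> R) :
  compact K -> ((g \_ K) \o vec) \in Lfun (leb d) 1%:E ->
  (forall x, ~ K x -> psi x = 0) -> Ck 0 setT psi ->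
  (leb d).-integrable setT (fun t => (g (vec t) * psi (vec t))%:E).
Proof.
move=> cK /Lfun1_integrable gK h0 cpsi.
have cpsi' x : {for x, continuous psi} by exact: (Ck_continuous cpsi).
have [N hN] := continuous_compact_bounded cpsi' (compact_supported cK h0).
have := @integrableMl _ _ _ (leb d) setT measurableT _ (fun t => psi (vec t)) gK
  (measurable_continuous_vec cpsi').
have -> : ((EFin \o ((g \_ K) \o vec)) \* (EFin \o (fun t => psi (vec t))))%E =
    (fun t => (g (vec t) * psi (vec t))%:E).
  apply/funext => t /=; rewrite -EFinM patchE; case: ifPn => // /negP Kt.
  by rewrite h0 ?mulr0// => Kt'; apply: Kt; rewrite inE.
apply; exists N; split=> [|M NM t _] /=; first exact: num_real.
by rewrite (le_trans (hN _))// ltW.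
Qed.

(** The weight c is smooth of every order because c times a partial derivative of phi has to be a
    test function again. G is never identified with the classical gradient of u: it only occurs
    integrated against such functions. *)
Lemma weak_to_strong (U : set 'rV[R]_d) (u c V : 'rV[R]_d -> R)
    (G : 'rV[R]_d -> 'rV[R]_d) : open U ->
  (forall i, in_Lloc 1 U (fun x => G x 0 i)) ->
  (forall phi, test_function U phi -> forall i,
     intRd (fun x => u x * partial i phi x) = - intRd (fun x => G x 0 i * phi x)) ->
  Ck 2 U u -> (forall k, Ck k U c) -> Ck 0 U V ->
  (forall phi, test_function U phi ->
    intRd (fun x => c x * dotrv (G x) (gradient phi x)) =
    intRd (fun x => V x * phi x)) ->
  forall x, U x ->
    \sum_(i < d) partial i (fun y => c y * partial i u y) x + V x = 0.
Proof.
move=> oU iG hG cu cc cV hV x Ux.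
pose A i := partial i (fun y => c y * partial i u y).
have cA1 i : Ck 1 U (fun y => c y * partial i u y).
  by apply: Ck_mul => //; exact: Ck_partial.
have cA i : Ck 0 U (A i) by exact: Ck_partial.
have cS : Ck 0 U (fun x => \sum_(i < d) A i x) by exact: Ck_sum.
apply: (@fundamental_lemma U (fun x => \sum_(i < d) A i x + V x)) => //.
  exact: Ck_add.
move=> phi tphi; have [sphi [K [cK KU] K0]] := tphi.
have K0' i y : ~ K y -> partial i phi y = 0.
  by move=> Ky; exact: (partial_off_support i cK K0 Ky).
pose psi i y := c y * partial i phi y.
have psi0 i y : ~ K y -> psi i y = 0 by move=> Ky; rewrite /psi K0' ?mulr0.
have spsi i k : Ck k setT (psi i).
  by apply: (Ck_mul_supported oU cK KU (K0' i)) => //; exact: Ck_partial.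
have tpsi i : test_function U (psi i).
  by split => //; exists K => //; exact: psi0.
have E1 : intRd (fun x => c x * dotrv (G x) (gradient phi x)) =
    \sum_(i < d) intRd (fun x => G x 0 i * psi i x).
  have hi i : (leb d).-integrable setT (fun t => (G (vec t) 0 i * psi i (vec t))%:E).
    exact: (Lloc_integrable_mul cK (iG i K cK KU) (psi0 i) (spsi i 0%N)).
  rewrite -(@intRd_sum d (fun i x => G x 0 i * psi i x) hi).1; apply: eq_Rintegral => t _.
  rewrite /dotrv mulr_sumr; apply: eq_bigr => i _.
  by rewrite mxE /psi; ring.
(* With d_i the partial derivative, the integrals of the following functions agree in turn: G_i
   psi_i, - u d_i psi_i, (d_i u) psi_i, (c d_i u) d_i phi, and - A_i phi. *)
have E2 i : intRd (fun x => G x 0 i * psi i x) = - intRd (fun x => A i x * phi x).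
  rewrite -[LHS]opprK -hG//; congr (- _).
  have := @intRd_by_parts U K u (psi i) i oU cK KU (psi0 i) (CkW (leqnSn 1) cu) (spsi i 1%N).
  move=> /(congr1 -%R); rewrite opprK => <-.
  rewrite (intRd_by_parts i oU cK KU K0 (cA1 i) (sphi 1%N)); congr (- _).
  by apply: eq_Rintegral => t _; rewrite /psi; ring.
have iA i : (leb d).-integrable setT (fun t => (A i (vec t) * phi (vec t))%:E).
  exact: (integrable_mul_supported oU cK KU K0).
have [S1 S2] := @intRd_sum d (fun i x => A i x * phi x) iA.
have -> : intRd (fun x => (\sum_(i < d) A i x + V x) * phi x) =
    intRd (fun x => \sum_(i < d) A i x * phi x) + intRd (fun x => V x * phi x).
  rewrite /intRd -RintegralD//.
    by apply: eq_Rintegral => t _; rewrite mulrDl mulr_suml.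
  exact: (integrable_mul_supported oU cK KU K0).
rewrite S1 -hV// E1 -big_split /= big1// => i _.
by rewrite E2 subrr.
Qed.

End weak_to_strong.

(** * Calculus in polar coordinates *)

Section polar_calculus.
Context {R : realType} {d : nat}.
Local Notation fct := (R -> 'rV[R]_d -> R).
Implicit Types (f g : fct) (r s : R) (x t : 'rV[R]_d).

(** Cartesian form of a function of (r, theta): [Ck_polar k f] unfolds to the class C^k of [cart f]
    on the punctured space. *)
Definition cart f : 'rV[R]_d -> R := fun x => f (enorm x) ((enorm x)^-1 *: x).

(* Like [dr], a derivation; it is the i-th component of [grad_theta], and
   [laplace_beltrami] is the sum of the squares of these derivations. *)
Definition tang (i : 'I_d) f : fct := fun r t => partial i (hext (f r)) t.

Lemma sphere_neq0 t : sphere t -> t != 0.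
Proof.
move=> st; apply/eqP => t0; move: st; rewrite /sphere /= t0 /enorm /dotrv.
rewrite big1 ?sqrtr0; last by move=> i _; rewrite mxE mul0r.
by move/eqP; rewrite eq_sym oner_eq0.
Qed.

Lemma polar_neq0 r t : 0 < r -> sphere t -> r *: t != 0.
Proof.
by move=> r0 /sphere_neq0 t0; rewrite scaler_eq0 negb_or t0 gt_eqF.
Qed.

Lemma enorm_polar r t : 0 < r -> sphere t -> enorm (r *: t) = r.
Proof. by move=> r0 st; rewrite enormZ ?ltW// st mulr1. Qed.

Lemma cartE f r t : 0 < r -> sphere t -> cart f (r *: t) = f r t.
Proof.
move=> r0 st; rewrite /cart enorm_polar// scalerA mulVf ?scale1r//.
by rewrite gt_eqF.
Qed.

Lemma sphere_unit x : x != 0 -> sphere ((enorm x)^-1 *: x).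
Proof.
move=> /enorm_gt0 x0; rewrite /sphere /= enormZ ?invr_ge0 ?ltW//.
by rewrite mulVf// gt_eqF.
Qed.

Lemma unit_sphere t : sphere t -> (enorm t)^-1 *: t = t.
Proof. by move=> st; rewrite st invr1 scale1r. Qed.

Lemma polar_decomp x : x != 0 -> x = enorm x *: ((enorm x)^-1 *: x).
Proof.
by move=> /enorm_gt0 x0; rewrite scalerA mulfV ?scale1r// gt_eqF.
Qed.

Lemma sphere_sum_sqr t : sphere t -> \sum_(i < d) t 0 i * t 0 i = 1.
Proof. by move=> st; rewrite -[LHS]/(dotrv t t) -sqr_enorm st expr1n. Qed.

Lemma Ck_cart k f : Ck_polar k f -> Ck k punctured (cart f).
Proof. by []. Qed.

Lemma Ck_polar_eq k f g :
  (forall r t, 0 < r -> sphere t -> f r t = g r t) ->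
  Ck_polar k f -> Ck_polar k g.
Proof.
move=> fg; apply: Ck_eq; first exact: open_punctured.
by move=> x x0; apply: fg; [exact: enorm_gt0|exact: sphere_unit].
Qed.

Lemma Ck_polarW k l f : (l <= k)%N -> Ck_polar k f -> Ck_polar l f.
Proof. exact: CkW. Qed.

Lemma Ck_unit k j :
  Ck k punctured (fun x : 'rV[R]_d => ((enorm x)^-1 *: x) 0 j).
Proof.
have oP := @open_punctured R d.
apply: (@Ck_eq _ _ _ _ (fun x => (enorm x)^-1 * x 0 j)) => //.
  by move=> x _; rewrite mxE.
apply: Ck_mul => //; last exact: Ck_coord.
by apply: Ck_inv => //; [exact: enorm_gt0|exact: Ck_enorm].
Qed.

(** On the sphere, the differential of x -> x/|x| is the orthogonal projection onto the tangent
    space, with matrix I - t^T t. *)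
Lemma is_derive_unit i j t : sphere t -> is_derive t (delta_mx 0 i)
  (fun x : 'rV[R]_d => ((enorm x)^-1 *: x) 0 j) ((i == j)%:R - t 0 i * t 0 j).
Proof.
move=> st; have t0 := sphere_neq0 st.
have dt : dotrv t t = 1 by rewrite -sqr_enorm st expr1n.
have hd : is_derive t (delta_mx 0 i) (fun x : 'rV[R]_d => dotrv x x) (2 * t 0 i).
  have hk (k : 'I_d) : is_derive t (delta_mx 0 i) (fun x : 'rV[R]_d => x 0 k * x 0 k)
      ((i == k)%:R * t 0 k + t 0 k * (i == k)%:R).
    by apply: is_derive_mul; exact: is_derive_coord.
  apply: (is_derive_eq (is_derive_bigsum hk)).
  rewrite (bigD1 i)//= eqxx big1 ?addr0 /=; first by ring.
  by move=> k; rewrite eq_sym => /negPf ->; rewrite mul0r mulr0 addr0.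
have d0 : 0 < dotrv t t by exact: dotrv_gt0.
(* The normalized coordinate is written as the power -1/2 of the polynomial x.x, times x_j. *)
have hp := @is_derive_comp1 _ _ _ (fun x => dotrv x x) _ _ _ _ (is_derive1_powR (- 2^-1) d0) hd.
rewrite dt powR1 mulr1 in hp.
have hm := is_derive_mul hp (is_derive_coord i j t).
rewrite dt powR1 in hm.
apply: (@near_eq_is_derive _ _ _ (fun x : 'rV[R]_d => dotrv x x `^ (- 2^-1) * x 0 j)).
  apply: (near_eq_open open_punctured _ t0) => y y0.
  by rewrite mxE powRN powR12_sqrt// dotrv_ge0.
by apply: (is_derive_eq hm); field.
Qed.

Lemma is_derive_polar f r t : Ck_polar 1 f -> 0 < r -> sphere t ->
  is_derive r (1 : R) (fun s => f s t)
    (\sum_(j < d) partial j (cart f) (r *: t) * t 0 j).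
Proof.
move=> cf r0 st.
have h : is_derive r (1 : R) (fun s => cart f (s *: t))
    (\sum_(j < d) partial j (cart f) (r *: t) * t 0 j).
  apply: (@is_derive_chain _ _ _ (cart f) (fun s : R => s *: t)).
    exact: (Ck_differentiable open_punctured (Ck_cart cf) (polar_neq0 r0 st)).
  move=> j.
  have h1 : is_derive r (1 : R) (fun s : R => s * t 0 j) (1 * t 0 j + r * 0).
    by apply: is_derive_mul.
  rewrite mul1r mulr0 addr0 in h1.
  by rewrite (_ : (fun y => _) = (fun s : R => s * t 0 j))//; apply/funext => y; rewrite mxE.
apply: near_eq_is_derive h.
have n0 : \forall s \near r, 0 < s by exact: lt_nbhsr.
by apply: filterS n0 => s s0; rewrite cartE.
Qed.

Lemma dr_partial f r t : Ck_polar 1 f -> 0 < r -> sphere t ->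
  dr f r t = \sum_(j < d) partial j (cart f) (r *: t) * t 0 j.
Proof.
by move=> cf r0 st; rewrite /dr derive1E; have [_ ->] := is_derive_polar cf r0 st.
Qed.

Lemma is_derive_dr f r t : Ck_polar 1 f -> 0 < r -> sphere t ->
  is_derive r (1 : R) (fun s => f s t) (dr f r t).
Proof.
by move=> cf r0 st; rewrite dr_partial//; exact: is_derive_polar.
Qed.

Lemma hext_cart f r x : 0 < r -> x != 0 ->
  hext (f r) x = cart f (r *: ((enorm x)^-1 *: x)).
Proof. by move=> r0 x0; rewrite cartE//; exact: sphere_unit. Qed.

Lemma is_derive_hext f i r t : Ck_polar 1 f -> 0 < r -> sphere t ->
  is_derive t (delta_mx 0 i) (hext (f r))
    (\sum_(j < d) partial j (cart f) (r *: t) *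
      (r * ((i == j)%:R - t 0 i * t 0 j))).
Proof.
move=> cf r0 st; have t0 := sphere_neq0 st.
apply: (@near_eq_is_derive _ _ _ (fun x => cart f (r *: ((enorm x)^-1 *: x)))).
  by apply: (near_eq_open open_punctured _ t0) => y y0; rewrite hext_cart.
have h := @is_derive_chain _ _ _ (cart f) (fun x => r *: ((enorm x)^-1 *: x)) t
  (delta_mx 0 i) (fun j => r * ((i == j)%:R - t 0 i * t 0 j)).
rewrite /= unit_sphere// in h; apply: h.
  exact: (Ck_differentiable open_punctured (Ck_cart cf) (polar_neq0 r0 st)).
move=> j; have h1 : is_derive t (delta_mx 0 i)
    (fun x : 'rV[R]_d => r * ((enorm x)^-1 *: x) 0 j)
    (0 * ((enorm t)^-1 *: t) 0 j + r * ((i == j)%:R - t 0 i * t 0 j)).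
  by apply: is_derive_mul; exact: is_derive_unit.
rewrite mul0r add0r in h1.
by rewrite (_ : (fun y => _) = (fun x : 'rV[R]_d => r * ((enorm x)^-1 *: x) 0 j))//;
  apply/funext => y; rewrite mxE.
Qed.

Lemma tang_partial f i r t : Ck_polar 1 f -> 0 < r -> sphere t ->
  tang i f r t = \sum_(j < d) partial j (cart f) (r *: t) *
      (r * ((i == j)%:R - t 0 i * t 0 j)).
Proof.
by move=> cf r0 st; rewrite /tang /partial; have [_ ->] := is_derive_hext i cf r0 st.
Qed.

Lemma is_derive_tang f i r t : Ck_polar 1 f -> 0 < r -> sphere t ->
  is_derive t (delta_mx 0 i) (hext (f r)) (tang i f r t).
Proof. by move=> cf r0 st; rewrite tang_partial//; exact: is_derive_hext. Qed.

(** Splitting of the Euclidean gradient into its radial part and its tangential part, the latter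
    scaled by 1/r. *)
Lemma partial_cart f i r t : Ck_polar 1 f -> 0 < r -> sphere t ->
  partial i (cart f) (r *: t) = t 0 i * dr f r t + r^-1 * tang i f r t.
Proof.
move=> cf r0 st; rewrite dr_partial// tang_partial//.
rewrite !mulr_sumr -big_split /= (bigD1 i)//= eqxx big1 ?addr0 /=.
  by field; rewrite gt_eqF.
by move=> j; rewrite eq_sym => /negPf -> /=; field; rewrite gt_eqF.
Qed.

(** Tangency of the spherical gradient: pair [partial_cart] with t and use |t| = 1. The radial
    derivative is recovered and nothing else remains. *)
Lemma sum_tang0 f r t : Ck_polar 1 f -> 0 < r -> sphere t ->
  \sum_(i < d) t 0 i * tang i f r t = 0.
Proof.
move=> cf r0 st.
have E (i : 'I_d) : t 0 i * tang i f r t =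
    r * (t 0 i * partial i (cart f) (r *: t)) - r * dr f r t * (t 0 i * t 0 i).
  rewrite partial_cart//; field; by rewrite gt_eqF.
under eq_bigr do rewrite E.
rewrite sumrB -!mulr_sumr sphere_sum_sqr// dr_partial//.
by under eq_bigr do rewrite mulrC; rewrite mulr1 subrr.
Qed.

Lemma Ck_polar_dr k f : Ck_polar k.+1 f -> Ck_polar k (dr f).
Proof.
move=> cf; have oP := @open_punctured R d.
have cf1 : Ck_polar 1 f by exact: CkW cf.
apply: (@Ck_eq _ _ _ _ (fun x => \sum_(j < d) partial j (cart f) x *
    ((enorm x)^-1 *: x) 0 j)) => //.
  move=> x x0; rewrite dr_partial//.
  - by rewrite -polar_decomp.
  - exact: enorm_gt0.
  - exact: sphere_unit.
apply: Ck_sum => // j; apply: Ck_mul => //; last exact: Ck_unit.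
exact: (Ck_partial j (Ck_cart cf)).
Qed.

Lemma Ck_polar_tang k i f : Ck_polar k.+1 f -> Ck_polar k (tang i f).
Proof.
move=> cf; have oP := @open_punctured R d.
have cf1 : Ck_polar 1 f by exact: CkW cf.
apply: (@Ck_eq _ _ _ _ (fun x => \sum_(j < d) partial j (cart f) x *
    (enorm x * ((i == j)%:R - ((enorm x)^-1 *: x) 0 i * ((enorm x)^-1 *: x) 0 j)))) => //.
  move=> x x0; rewrite tang_partial//.
  - by rewrite -polar_decomp.
  - exact: enorm_gt0.
  - exact: sphere_unit.
apply: Ck_sum => // j; apply: Ck_mul => //; first exact: (Ck_partial j (Ck_cart cf)).
apply: Ck_mul => //; first exact: Ck_enorm.
apply: Ck_sub => //; first exact: Ck_cst.
by apply: Ck_mul => //; exact: Ck_unit.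
Qed.

End polar_calculus.

(** * Rules of derivation for [dr] and [tang] *)

Section polar_derivations.
Context {R : realType} {d : nat}.
Local Notation fct := (R -> 'rV[R]_d -> R).
Implicit Types (f g : fct) (r s : R) (x t : 'rV[R]_d).

Lemma Ck_polar_cst k (c : R) : @Ck_polar R d k (fun _ _ => c).
Proof. by apply: Ck_cst; exact: open_punctured. Qed.

Lemma Ck_polar_add k f g : Ck_polar k f -> Ck_polar k g ->
  Ck_polar k (fun r t => f r t + g r t).
Proof. by apply: Ck_add; exact: open_punctured. Qed.

Lemma Ck_polar_sub k f g : Ck_polar k f -> Ck_polar k g ->
  Ck_polar k (fun r t => f r t - g r t).
Proof. by apply: Ck_sub; exact: open_punctured. Qed.

Lemma Ck_polar_mul k f g : Ck_polar k f -> Ck_polar k g ->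
  Ck_polar k (fun r t => f r t * g r t).
Proof. by apply: Ck_mul; exact: open_punctured. Qed.

Lemma Ck_polar_sum k n (f : 'I_n -> fct) : (forall i, Ck_polar k (f i)) ->
  Ck_polar k (fun r t => \sum_(i < n) f i r t).
Proof.
move=> cf; have := @Ck_sum _ _ k punctured n (fun i => cart (f i)).
by apply; [exact: open_punctured|exact: cf].
Qed.

Lemma Ck_polar_coord k j : @Ck_polar R d k (fun _ t => t 0 j).
Proof. exact: Ck_unit. Qed.

Lemma Ck_polar_rad k (c : R) : @Ck_polar R d k (fun r _ => r `^ c).
Proof. exact: Ck_enorm_powR. Qed.

Lemma Ck_polar_powR k f (c : R) :
  (forall r t, 0 < r -> sphere t -> 0 < f r t) -> Ck_polar k f ->
  Ck_polar k (fun r t => f r t `^ c).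
Proof.
move=> f0; apply: Ck_powR; first exact: open_punctured.
by move=> x x0; apply: f0; [exact: enorm_gt0|exact: sphere_unit].
Qed.

Local Opaque Ck_polar.

Lemma hext_sphere {T : Type} (h : 'rV[R]_d -> T) t : sphere t -> hext h t = h t.
Proof. by move=> st; rewrite /hext unit_sphere. Qed.

Lemma dr_eq f g r t : (forall r t, 0 < r -> sphere t -> f r t = g r t) ->
  0 < r -> sphere t -> dr f r t = dr g r t.
Proof.
move=> fg r0 st; rewrite /dr !derive1E; apply: near_eq_derive.
have n0 : \forall s \near r, 0 < s by exact: lt_nbhsr.
by apply: filterS n0 => s s0; exact: fg.
Qed.

Lemma tang_eq i f g r t : (forall t, sphere t -> f r t = g r t) ->
  sphere t -> tang i f r t = tang i g r t.
Proof.
move=> fg st; apply: (partial_eq i open_punctured) (sphere_neq0 st) => y y0.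
by apply: fg; exact: sphere_unit.
Qed.

Section at_a_point.
Variables (r : R) (t : 'rV[R]_d).
Hypotheses (r0 : 0 < r) (st : sphere t).

Lemma dr_val f df : is_derive r (1 : R) (fun s => f s t) df -> dr f r t = df.
Proof. by move=> [_ <-]; rewrite /dr derive1E. Qed.

Lemma tang_val i f df : is_derive t (delta_mx 0 i) (hext (f r)) df ->
  tang i f r t = df.
Proof. by move=> [_ <-]. Qed.

Lemma dr_add f g : Ck_polar 1 f -> Ck_polar 1 g ->
  dr (fun r t => f r t + g r t) r t = dr f r t + dr g r t.
Proof. by move=> cf cg; apply: dr_val; apply: is_derive_add; exact: is_derive_dr. Qed.

Lemma tang_add i f g : Ck_polar 1 f -> Ck_polar 1 g ->
  tang i (fun r t => f r t + g r t) r t = tang i f r t + tang i g r t.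
Proof.
move=> cf cg; apply: tang_val.
exact: (is_derive_add (is_derive_tang i cf r0 st) (is_derive_tang i cg r0 st)).
Qed.

Lemma dr_sub f g : Ck_polar 1 f -> Ck_polar 1 g ->
  dr (fun r t => f r t - g r t) r t = dr f r t - dr g r t.
Proof.
move=> cf cg; apply: dr_val.
exact: (is_derive_add (is_derive_dr cf r0 st) (is_derive_oppr (is_derive_dr cg r0 st))).
Qed.

Lemma tang_sub i f g : Ck_polar 1 f -> Ck_polar 1 g ->
  tang i (fun r t => f r t - g r t) r t = tang i f r t - tang i g r t.
Proof.
move=> cf cg; apply: tang_val.
exact: (is_derive_add (is_derive_tang i cf r0 st)
  (is_derive_oppr (is_derive_tang i cg r0 st))).
Qed.

Lemma dr_mul f g : Ck_polar 1 f -> Ck_polar 1 g ->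
  dr (fun r t => f r t * g r t) r t = dr f r t * g r t + f r t * dr g r t.
Proof.
move=> cf cg; apply: dr_val.
exact: (is_derive_mul (is_derive_dr cf r0 st) (is_derive_dr cg r0 st)).
Qed.

Lemma tang_mul i f g : Ck_polar 1 f -> Ck_polar 1 g ->
  tang i (fun r t => f r t * g r t) r t =
  tang i f r t * g r t + f r t * tang i g r t.
Proof.
move=> cf cg; apply: tang_val.
have := is_derive_mul (is_derive_tang i cf r0 st) (is_derive_tang i cg r0 st).
by rewrite !hext_sphere.
Qed.

Lemma dr_sum n (f : 'I_n -> fct) : (forall i, Ck_polar 1 (f i)) ->
  dr (fun r t => \sum_(i < n) f i r t) r t = \sum_(i < n) dr (f i) r t.
Proof.
move=> cf; apply: dr_val.
exact: (is_derive_bigsum (fun i => is_derive_dr (cf i) r0 st)).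
Qed.

Lemma dr_comp (h : R -> R) f dh : Ck_polar 1 f ->
  is_derive (f r t) (1 : R) h dh ->
  dr (fun r t => h (f r t)) r t = dh * dr f r t.
Proof.
move=> cf hh; apply: dr_val.
exact: (@is_derive_comp1 _ _ h (fun s => f s t) _ _ _ _ hh (is_derive_dr cf r0 st)).
Qed.

Lemma tang_comp i (h : R -> R) f dh : Ck_polar 1 f ->
  is_derive (f r t) (1 : R) h dh ->
  tang i (fun r t => h (f r t)) r t = dh * tang i f r t.
Proof.
move=> cf hh; apply: tang_val.
rewrite -(hext_sphere (f r) st) in hh.
exact: (@is_derive_comp1 _ _ h (hext (f r)) _ _ _ _ hh (is_derive_tang i cf r0 st)).
Qed.

Lemma dr_cst (c : 'rV[R]_d -> R) : dr (fun _ t => c t) r t = 0.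
Proof. by rewrite /dr derive1_cst. Qed.

Lemma tang_rad i (c : R -> R) : tang i (fun r _ => c r) r t = 0.
Proof. exact: derive_cst. Qed.

Lemma dr_rad (c : R) : @dr R d (fun r _ => r `^ c) r t = c * r `^ (c - 1).
Proof. by apply: dr_val; exact: is_derive1_powR. Qed.

Lemma tang_coord i j : tang i (fun _ t => t 0 j) r t = (i == j)%:R - t 0 i * t 0 j.
Proof. by apply: tang_val; exact: is_derive_unit. Qed.

Lemma dr_scale (c : R) f : Ck_polar 1 f ->
  dr (fun r t => c * f r t) r t = c * dr f r t.
Proof.
by move=> cf; rewrite (dr_mul (Ck_polar_cst 1 c) cf) (dr_cst (fun=> c)) mul0r add0r.
Qed.

(** A factor depending on r alone is a constant for tangential derivations, because [tang] freezes
    r. *)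
Lemma tang_scale i (c : R -> R) f : Ck_polar 1 f ->
  tang i (fun r t => c r * f r t) r t = c r * tang i f r t.
Proof.
move=> cf.
transitivity (tang i (fun s t => c r * f s t) r t); first by [].
rewrite (tang_mul i (Ck_polar_cst 1 (c r)) cf).
by rewrite (tang_rad i (fun=> c r)) mul0r add0r.
Qed.

End at_a_point.

Lemma laplace_beltrami_tang f r t :
  laplace_beltrami (f r) t = \sum_(i < d) tang i (tang i f) r t.
Proof.
apply: eq_bigr => i _; congr (partial i _ t).
by apply/funext => x; rewrite /hext /grad_theta mxE.
Qed.

Lemma dotrv_grad_theta f g r t :
  dotrv (grad_theta (f r) t) (grad_theta (g r) t) =
  \sum_(i < d) tang i f r t * tang i g r t.
Proof. by apply: eq_bigr => i _; rewrite !mxE. Qed.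

End polar_derivations.

Section cartesian_divergence.
Local Opaque Ck_polar dr tang.
Context {R : realType} {d : nat}.
Implicit Types (f : R -> 'rV[R]_d -> R) (r : R) (t : 'rV[R]_d).

(* The commutator of [dr] and [tang i] never appears: it is contracted with
   [t 0 i], and [\sum_i t 0 i * tang i f = 0] can be differentiated in r. *)
Lemma divergence_polar f (c r : R) t : Ck_polar 2 f -> 0 < r -> sphere t ->
  \sum_(i < d) partial i (fun y => enorm y `^ c * partial i (cart f) y) (r *: t) =
  r `^ c * (dr (dr f) r t + (d%:R - 1 + c) / r * dr f r t +
    laplace_beltrami (f r) t / r ^+ 2).
Proof.
move=> cf r0 st; have oP := @open_punctured R d.
have cf1 : Ck_polar 1 f by exact: (Ck_polarW (leqnSn 1) cf).
have cdr : Ck_polar 1 (dr f) by exact: Ck_polar_dr.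
have ctg i : Ck_polar 1 (tang i f) by exact: Ck_polar_tang.
(* Polar form of the i-th component of the weighted gradient; the factor 1/r of the tangential part
   is absorbed in the exponent c - 1. *)
pose a (i : 'I_d) r t := r `^ c * (t 0 i * dr f r t) + r `^ (c - 1) * tang i f r t.
have ccd (i : 'I_d) : Ck_polar 1 (fun r t => t 0 i * dr f r t).
  exact: (Ck_polar_mul (Ck_polar_coord 1 i) cdr).
have cct i : Ck_polar 1 (fun s t => t 0 i * tang i f s t).
  exact: (Ck_polar_mul (Ck_polar_coord 1 i) (ctg i)).
have ca1 i : Ck_polar 1 (fun r t => r `^ c * (t 0 i * dr f r t)).
  exact: (Ck_polar_mul (Ck_polar_rad 1 c) (ccd i)).
have ca2 i : Ck_polar 1 (fun r t => r `^ (c - 1) * tang i f r t).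
  exact: (Ck_polar_mul (Ck_polar_rad 1 (c - 1)) (ctg i)).
have ca i : Ck_polar 1 (a i) by exact: (Ck_polar_add (ca1 i) (ca2 i)).
have E i : partial i (fun y => enorm y `^ c * partial i (cart f) y) (r *: t) =
    t 0 i * dr (a i) r t + r^-1 * tang i (a i) r t.
  rewrite -(partial_cart i (ca i) r0 st); apply: (partial_eq i oP) (polar_neq0 r0 st) => y y0.
  rewrite {2}(polar_decomp y0) (partial_cart i cf1 (enorm_gt0 y0) (sphere_unit y0)).
  rewrite /cart /a (powR_sub1 _ (enorm_gt0 y0)).
  move: (dr f _ _) (tang i f _ _) (enorm y `^ c) (_ 0 i) => *; ring.
have daE i : dr (a i) r t = c * r `^ (c - 1) * (t 0 i * dr f r t) +
    r `^ c * (t 0 i * dr (dr f) r t) + (c - 1) * r `^ (c - 1 - 1) * tang i f r t +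
    r `^ (c - 1) * dr (tang i f) r t.
  rewrite /a (dr_add r0 st (ca1 i) (ca2 i)).
  rewrite (dr_mul r0 st (Ck_polar_rad 1 c) (ccd i)).
  rewrite (dr_mul r0 st (Ck_polar_rad 1 (c - 1)) (ctg i)).
  rewrite (dr_mul r0 st (Ck_polar_coord 1 i) cdr).
  rewrite (dr_rad t r0 c) (dr_rad t r0 (c - 1)) (dr_cst r t (fun t => t 0 i)).
  move: (dr f r t) (dr (dr f) r t) (tang i f r t) (dr (tang i f) r t)
    (r `^ (c - 1 - 1)) (r `^ (c - 1)) (r `^ c) (t 0 i) => *; ring.
have taE i : tang i (a i) r t = r `^ c * ((1 - t 0 i * t 0 i) * dr f r t +
    t 0 i * tang i (dr f) r t) + r `^ (c - 1) * tang i (tang i f) r t.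
  rewrite /a (tang_add r0 st i (ca1 i) (ca2 i)).
  rewrite (tang_scale r0 st i (fun r => r `^ c) (ccd i)).
  rewrite (tang_scale r0 st i (fun r => r `^ (c - 1)) (ctg i)).
  rewrite (tang_mul r0 st i (Ck_polar_coord 1 i) cdr).
  by rewrite (tang_coord r st i i) eqxx.
have sdt0 : \sum_(i < d) t 0 i * dr (tang i f) r t = 0.
  have := @dr_sum _ _ r t r0 st d (fun i s t => t 0 i * tang i f s t).
  move=> /(_ cct).
  have -> : dr (fun s t => \sum_(i < d) t 0 i * tang i f s t) r t = 0.
    rewrite (@dr_eq _ _ _ (fun _ _ => 0) r t _ r0 st).
      exact: (dr_cst _ _ (fun=> 0)).
    by move=> s t' s0 st'; exact: sum_tang0.
  move=> /esym H; rewrite -[RHS]H; apply: eq_bigr => i _.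
  rewrite (dr_mul r0 st (Ck_polar_coord 1 i) (ctg i)).
  by rewrite (dr_cst r t (fun t => t 0 i)) mul0r add0r.
under eq_bigr do rewrite E daE taE.
rewrite laplace_beltrami_tang.
(* Six sums are collected. The first five have known values, in order 1, 0, 0, d and 0; the last one
   is the Laplace-Beltrami term. The coefficient d - 1 + c of the radial derivative arises as c from
   the weight and d - 1 from the trace of the tangential projection. *)
have -> : \sum_(i < d) (t 0 i *
   (c * r `^ (c - 1) * (t 0 i * dr f r t) + r `^ c * (t 0 i * dr (dr f) r t) +
    (c - 1) * r `^ (c - 1 - 1) * tang i f r t + r `^ (c - 1) * dr (tang i f) r t) +
   r^-1 * (r `^ c * ((1 - t 0 i * t 0 i) * dr f r t + t 0 i * tang i (dr f) r t) +
    r `^ (c - 1) * tang i (tang i f) r t)) =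
  (c * r `^ (c - 1) * dr f r t + r `^ c * dr (dr f) r t - r^-1 * r `^ c * dr f r t) *
     (\sum_(i < d) t 0 i * t 0 i) +
  (c - 1) * r `^ (c - 1 - 1) * (\sum_(i < d) t 0 i * tang i f r t) +
  r `^ (c - 1) * (\sum_(i < d) t 0 i * dr (tang i f) r t) +
  r^-1 * r `^ c * dr f r t * (\sum_(i < d) 1) +
  r^-1 * r `^ c * (\sum_(i < d) t 0 i * tang i (dr f) r t) +
  r^-1 * r `^ (c - 1) * (\sum_(i < d) tang i (tang i f) r t).
  rewrite !mulr_sumr -!big_split /=; apply: eq_bigr => i _.
  move: (dr f r t) (dr (dr f) r t) (tang i f r t) (dr (tang i f) r t)
    (tang i (dr f) r t) (tang i (tang i f) r t) (r `^ (c - 1 - 1))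
    (r `^ (c - 1)) (r `^ c) (t 0 i) => *; ring.
have key (A B C D X F S1 S2 S3 S4 S5 S6 : R) : S1 = 1 -> S2 = 0 -> S3 = 0 ->
    S4 = d%:R -> S5 = 0 ->
    A * S1 + B * S2 + C * S3 + D * S4 + X * S5 + F * S6 = A + D * d%:R + F * S6.
  by move=> -> -> -> -> ->; ring.
have Sd : \sum_(i < d) (1 : R) = d%:R by rewrite sumr_const card_ord.
apply: (etrans (key _ _ _ _ _ _ _ _ _ _ _ _ (sphere_sum_sqr st)
  (sum_tang0 cf1 r0 st) sdt0 Sd (sum_tang0 cdr r0 st))).
rewrite (powR_sub1 c r0).
move: (dr f r t) (dr (dr f) r t) (\sum_(i < d) _) (r `^ c) => *; field.
by rewrite gt_eqF.
Qed.

End cartesian_divergence.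

(** * The weighted operators *)

Section weighted_operators.
Context {R : realType} {d : nat}.
Local Notation fct := (R -> 'rV[R]_d -> R).
Implicit Types (f g h : fct) (r : R) (t : 'rV[R]_d).
Local Opaque Ck_polar dr tang.

Lemma powRNnat (r : R) k : 0 < r -> r `^ (- k%:R) = (r ^+ k)^-1.
Proof. by move=> r0; rewrite powR_invn// ltW. Qed.

Lemma LopE alpha n f r t : Lop alpha n f r t =
  alpha ^+ 2 * dr (dr f) r t + alpha ^+ 2 * ((n - 1) / r) * dr f r t +
  (\sum_(i < d) tang i (tang i f) r t) / r ^+ 2.
Proof. by rewrite /Lop laplace_beltrami_tang. Qed.

Lemma DdotE alpha f g r t : Ddot alpha f g r t =
  alpha ^+ 2 * dr f r t * dr g r t +
  (\sum_(i < d) tang i f r t * tang i g r t) / r ^+ 2.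
Proof. by rewrite /Ddot dotrv_grad_theta. Qed.

Lemma Ck_polar_Ddot alpha k f g : Ck_polar k.+1 f -> Ck_polar k.+1 g ->
  Ck_polar k (Ddot alpha f g).
Proof.
move=> cf cg.
apply: (@Ck_polar_eq _ _ _ (fun r t => alpha ^+ 2 * (dr f r t * dr g r t) +
  (\sum_(i < d) tang i f r t * tang i g r t) * r `^ (- 2%:R))).
  by move=> r t r0 st; rewrite DdotE powRNnat// mulrA.
apply: Ck_polar_add.
  apply: (Ck_polar_mul (Ck_polar_cst k (alpha ^+ 2))).
  exact: (Ck_polar_mul (Ck_polar_dr cf) (Ck_polar_dr cg)).
apply: Ck_polar_mul; last exact: (Ck_polar_rad k (- 2%:R)).
apply: Ck_polar_sum => i.
exact: (Ck_polar_mul (Ck_polar_tang i cf) (Ck_polar_tang i cg)).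
Qed.

Lemma Ck_polar_Lop alpha n k f : Ck_polar k.+2 f -> Ck_polar k (Lop alpha n f).
Proof.
move=> cf.
apply: (@Ck_polar_eq _ _ _ (fun r t => (alpha ^+ 2 * dr (dr f) r t +
  alpha ^+ 2 * (n - 1) * r `^ (- 1%:R) * dr f r t) +
  (\sum_(i < d) tang i (tang i f) r t) * r `^ (- 2%:R))).
  by move=> r t r0 st; rewrite LopE !powRNnat// expr1 !mulrA.
have cdr := Ck_polar_dr cf.
apply: Ck_polar_add.
  apply: Ck_polar_add.
    exact: (Ck_polar_mul (Ck_polar_cst k (alpha ^+ 2)) (Ck_polar_dr cdr)).
  apply: Ck_polar_mul; last exact: (Ck_polarW (leqnSn k) cdr).
  exact: (Ck_polar_mul (Ck_polar_cst k (alpha ^+ 2 * (n - 1))) (Ck_polar_rad k _)).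
apply: Ck_polar_mul; last exact: (Ck_polar_rad k (- 2%:R)).
apply: Ck_polar_sum => i.
exact: (Ck_polar_tang i (Ck_polar_tang i cf)).
Qed.

Section at_a_point.
Variables (alpha n r : R) (t : 'rV[R]_d).
Hypotheses (r0 : 0 < r) (st : sphere t).

Lemma DdotC f g : Ddot alpha f g r t = Ddot alpha g f r t.
Proof.
rewrite !DdotE mulrAC; congr (_ + _ / _).
by apply: eq_bigr => i _; rewrite mulrC.
Qed.

Lemma Ddot_congr f g g' :
  (forall r t, 0 < r -> sphere t -> g r t = g' r t) ->
  Ddot alpha f g r t = Ddot alpha f g' r t.
Proof.
move=> gg'; rewrite !DdotE (dr_eq gg' r0 st); congr (_ + _ / _).
apply: eq_bigr => i _; congr (_ * _); apply: tang_eq => // t' st'.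
exact: gg'.
Qed.

Lemma Ddot_mulr f g h : Ck_polar 1 g -> Ck_polar 1 h ->
  Ddot alpha f (fun r t => g r t * h r t) r t =
  Ddot alpha f g r t * h r t + g r t * Ddot alpha f h r t.
Proof.
move=> cg ch; rewrite !DdotE (dr_mul r0 st cg ch).
have -> : \sum_(i < d) tang i f r t * tang i (fun r t => g r t * h r t) r t =
    (\sum_(i < d) tang i f r t * tang i g r t) * h r t +
    g r t * (\sum_(i < d) tang i f r t * tang i h r t).
  rewrite mulr_suml mulr_sumr -big_split /=; apply: eq_bigr => i _.
  rewrite (tang_mul r0 st i cg ch).
  move: (tang i f r t) (tang i g r t) (tang i h r t) (g r t) (h r t) => *; ring.
move: (\sum_(i < d) _) (\sum_(i < d) _) (dr f r t) (dr g r t) (dr h r t)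
  (g r t) (h r t) => *; field.
by rewrite gt_eqF.
Qed.

Lemma Ddot_compr (F : R -> R) f g dF : Ck_polar 1 g ->
  is_derive (g r t) (1 : R) F dF ->
  Ddot alpha f (fun r t => F (g r t)) r t = dF * Ddot alpha f g r t.
Proof.
move=> cg hF; rewrite !DdotE (dr_comp r0 st cg hF).
have -> : \sum_(i < d) tang i f r t * tang i (fun r t => F (g r t)) r t =
    dF * (\sum_(i < d) tang i f r t * tang i g r t).
  rewrite mulr_sumr; apply: eq_bigr => i _.
  rewrite (tang_comp r0 st i cg hF).
  by rewrite mulrCA.
move: (\sum_(i < d) _) (dr f r t) (dr g r t) => *; field.
by rewrite gt_eqF.
Qed.

(** Leibniz rule for the weighted divergence; differentiating r^(n-1) yields the first-order term (n
    - 1)/r of [Lop]. A difference of two fields is treated at once, as in the second identity of the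
    theorem. *)
Lemma Ddiv_sub_grad f g h k : Ck_polar 1 f -> Ck_polar 2 g ->
  Ck_polar 1 h -> Ck_polar 2 k ->
  Ddiv alpha n (fun s t => f s t *: Dop alpha g s t - h s t *: Dop alpha k s t) r t =
  (Ddot alpha g f r t + f r t * Lop alpha n g r t) -
  (Ddot alpha k h r t + h r t * Lop alpha n k r t).
Proof.
move=> cf cg ch ck.
have cdg := Ck_polar_dr cg; have cdk := Ck_polar_dr ck.
have ctg i := Ck_polar_tang i cg; have ctk i := Ck_polar_tang i ck.
have -> : Ddiv alpha n (fun s t => f s t *: Dop alpha g s t - h s t *: Dop alpha k s t) r t =
  alpha * r `^ (1 - n) * dr (fun s t => s `^ (n - 1) *
    (f s t * (alpha * dr g s t) - h s t * (alpha * dr k s t))) r t +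
  r^-1 * \sum_(i < d) tang i (fun s t =>
    f s t * (s^-1 * tang i g s t) - h s t * (s^-1 * tang i k s t)) r t.
  rewrite /Ddiv; congr (_ + _ * _); apply: eq_bigr => i _.
  congr (partial i _ t); apply/funext => x.
  by rewrite /hext !mxE.
have c1 : Ck_polar 1 (fun s t => f s t * (alpha * dr g s t)).
  exact: (Ck_polar_mul cf (Ck_polar_mul (Ck_polar_cst 1 alpha) cdg)).
have c2 : Ck_polar 1 (fun s t => h s t * (alpha * dr k s t)).
  exact: (Ck_polar_mul ch (Ck_polar_mul (Ck_polar_cst 1 alpha) cdk)).
rewrite (dr_mul r0 st (Ck_polar_rad 1 (n - 1)) (Ck_polar_sub c1 c2)).
rewrite (dr_sub r0 st c1 c2) (dr_rad t r0 (n - 1)).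
rewrite (dr_mul r0 st cf (Ck_polar_mul (Ck_polar_cst 1 alpha) cdg)).
rewrite (dr_mul r0 st ch (Ck_polar_mul (Ck_polar_cst 1 alpha) cdk)).
rewrite (dr_scale r0 st alpha cdg) (dr_scale r0 st alpha cdk).
have E i : tang i (fun s t =>
    f s t * (s^-1 * tang i g s t) - h s t * (s^-1 * tang i k s t)) r t =
  r^-1 * (tang i f r t * tang i g r t + f r t * tang i (tang i g) r t) -
  r^-1 * (tang i h r t * tang i k r t + h r t * tang i (tang i k) r t).
  have c1i : Ck_polar 1 (fun s t => f s t * tang i g s t) by exact: (Ck_polar_mul cf (ctg i)).
  have c2i : Ck_polar 1 (fun s t => h s t * tang i k s t) by exact: (Ck_polar_mul ch (ctk i)).
  (* The radius being frozen, the factor 1/s is the constant 1/r. *)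
  transitivity (tang i (fun s t => r^-1 * (f s t * tang i g s t - h s t * tang i k s t)) r t).
    rewrite -[LHS]/(partial i _ t) -[RHS]/(partial i _ t); congr (partial i _ t).
    apply/funext => x; rewrite /hext.
    move: (f _ _) (tang i g _ _) (h _ _) (tang i k _ _) => *; ring.
  rewrite (tang_scale r0 st i (fun=> r^-1) (Ck_polar_sub c1i c2i)).
  rewrite (tang_sub r0 st i c1i c2i).
  by rewrite (tang_mul r0 st i cf (ctg i)) (tang_mul r0 st i ch (ctk i)) mulrBr.
rewrite (eq_bigr _ (fun i _ => E i)) !DdotE !LopE.
have e2 : r `^ (1 - n) = (r `^ (n - 1))^-1 by rewrite -powRN opprB.
have p0 : r `^ (n - 1) != 0 by rewrite gt_eqF// powR_gt0.
rewrite (powR_sub1 (n - 1) r0) e2; move: p0 r0.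
(* Once [tang] and [dr] are variables, unification no longer unfolds limits. *)
clear; move: (@tang R d) (@dr R d) => T D p0 r0.
rewrite sumrB -!mulr_sumr !big_split /= -!mulr_sumr.
have -> : \sum_(i < d) T i g r t * T i f r t = \sum_(i < d) T i f r t * T i g r t.
  by apply: eq_bigr => i _; rewrite mulrC.
have -> : \sum_(i < d) T i k r t * T i h r t = \sum_(i < d) T i h r t * T i k r t.
  by apply: eq_bigr => i _; rewrite mulrC.
move: p0; move: (r `^ (n - 1)) => x9 p0.
field; by rewrite p0 gt_eqF.
Qed.

End at_a_point.

(** The value of K is immaterial, since the equation only enters differentiated. After cancellation
    of the common terms, both sides differ by a multiple, proportional to 1 - n, of the relation
    [key] below. *)
Lemma kop_divergence (alpha n K : R) (P : fct) :
  n != 0 -> Ck_polar 3 P -> (forall r t, 0 < r -> sphere t -> 0 < P r t) ->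
  (forall r t, 0 < r -> sphere t ->
    P r t * Lop alpha n P r t = K + n / 2 * Dsq alpha P r t) ->
  forall r t, 0 < r -> sphere t ->
  P r t `^ (1 - n) * kop alpha n P r t =
    Ddiv alpha n (fun s t =>
      (2^-1 * P s t `^ (1 - n)) *: Dop alpha (Dsq alpha P) s t -
      (n^-1 * P s t `^ (1 - n) * Lop alpha n P s t) *: Dop alpha P s t) r t.
Proof.
move=> n0 cP P0 H r t r0 st.
have cP1 : Ck_polar 1 P by exact: (Ck_polarW _ cP).
have cP2 : Ck_polar 2 P by exact: (Ck_polarW _ cP).
have cQ : Ck_polar 2 (Dsq alpha P) by exact: (Ck_polar_Ddot alpha cP cP).
have cQ1 : Ck_polar 1 (Dsq alpha P) by exact: (Ck_polarW _ cQ).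
have cL : Ck_polar 1 (Lop alpha n P) by exact: (Ck_polar_Lop alpha n cP).
have cM : Ck_polar 1 (fun s t => P s t `^ (1 - n)) by exact: (Ck_polar_powR _ P0 cP1).
have cM2 : Ck_polar 1 (fun s t => 2^-1 * P s t `^ (1 - n)).
  exact: (Ck_polar_mul (Ck_polar_cst 1 2^-1) cM).
have cMn : Ck_polar 1 (fun s t => n^-1 * P s t `^ (1 - n)).
  exact: (Ck_polar_mul (Ck_polar_cst 1 n^-1) cM).
rewrite (Ddiv_sub_grad alpha n r0 st cM2 cQ (Ck_polar_mul cMn cL) cP2).
rewrite (Ddot_mulr alpha r0 st P cMn cL).
have p0 := P0 _ _ r0 st.
have hd (c : R) : is_derive (P r t) (1 : R) (fun y => c * y `^ (1 - n))
    (c * ((1 - n) * P r t `^ (1 - n - 1))).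
  have := is_derive_mul (is_derive_cst c (P r t) (1 : R)) (is_derive1_powR (1 - n) p0).
  by rewrite mul0r add0r.
have D1 : Ddot alpha (Dsq alpha P) (fun s t => 2^-1 * P s t `^ (1 - n)) r t = _ :=
  Ddot_compr alpha r0 st (Dsq alpha P) cP1 (hd 2^-1).
have D2 : Ddot alpha P (fun s t => n^-1 * P s t `^ (1 - n)) r t = _ :=
  Ddot_compr alpha r0 st P cP1 (hd n^-1).
rewrite D1 D2.
rewrite (DdotC alpha r t (Dsq alpha P) P).
(* The pressure equation paired with DP: the left side by the Leibniz rule, the right side by the
   chain rule for y -> K + (n/2) y. *)
have key : Ddot alpha P P r t * Lop alpha n P r t + P r t * Ddot alpha P (Lop alpha n P) r t =
    n / 2 * Ddot alpha P (Dsq alpha P) r t.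
  rewrite -(Ddot_mulr alpha r0 st P cP1 cL) (Ddot_congr alpha r0 st P H).
  have hK : is_derive (Dsq alpha P r t) (1 : R) (fun y => K + n / 2 * y) (n / 2).
    have := is_derive_add (is_derive_cst K (Dsq alpha P r t) (1 : R))
      (is_derive_mul (is_derive_cst (n / 2) (Dsq alpha P r t) (1 : R)) (is_derive_id _ _)).
    by rewrite mul0r !add0r mulr1.
  exact: (Ddot_compr alpha r0 st P cQ1 hK).
rewrite /kop (powR_sub1 (1 - n) p0); move: key.
move: (Lop alpha n (Dsq alpha P) r t) (Ddot alpha P (Dsq alpha P) r t)
  (Ddot alpha P (Lop alpha n P) r t) (Ddot alpha P P r t) (Lop alpha n P r t)
  (P r t `^ (1 - n)) => LQ Y X Q L M.
move: (P r t) p0 => p p0 key.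
have -> : X = (n / 2 * Y - Q * L) / p by rewrite -key addrAC subrr add0r mulrC mulKf// gt_eqF.
by field; rewrite n0 gt_eqF.
Qed.

End weighted_operators.

(** * The pressure equation *)

Section pressure_equation.
Context {R : realType} {d : nat}.
Local Notation fct := (R -> 'rV[R]_d -> R).
Implicit Types (f g P : fct) (r s : R) (t : 'rV[R]_d).

(** In Cartesian form the substitution is x -> |x|^(alpha-1) x, a smooth map of the punctured space
    into itself. *)
Lemma Ck_polar_reparam k (alpha : R) f : Ck_polar k f ->
  Ck_polar k (fun r t => f (r `^ alpha) t).
Proof.
move=> cf; have oP := @open_punctured R d.
pose c (x : 'rV[R]_d) := enorm x `^ (alpha - 1) *: x.
have c0 x : x != 0 -> c x != 0.
  by move=> x0; rewrite scaler_eq0 negb_or x0 gt_eqF// powR_gt0// enorm_gt0.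
apply: (@Ck_eq _ _ _ _ (fun x => cart f (c x))) => //.
  move=> x x0; have e0 := enorm_gt0 x0.
  have cE : c x = enorm x `^ alpha *: ((enorm x)^-1 *: x).
    by rewrite /c scalerA powR_sub1.
  by rewrite cE cartE//; [exact: powR_gt0|exact: sphere_unit].
apply: (Ck_comp oP oP c0 (Ck_cart cf)) => j.
apply: (@Ck_eq _ _ _ _ (fun x => enorm x `^ (alpha - 1) * x 0 j)) => //.
  by move=> x _; rewrite mxE.
by apply: Ck_mul => //; [exact: Ck_enorm_powR|exact: Ck_coord].
Qed.

Local Opaque Ck_polar dr tang.

Lemma dr_reparam (alpha : R) f r t : Ck_polar 1 f -> 0 < r -> sphere t ->
  dr (fun r t => f (r `^ alpha) t) r t =
  alpha * r `^ (alpha - 1) * dr f (r `^ alpha) t.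
Proof.
move=> cf r0 st; apply: dr_val.
have h := is_derive_dr cf (powR_gt0 alpha r0) st.
have := @is_derive_comp1 _ _ (fun s => f s t) (fun s : R => s `^ alpha) r 1 _ _
  h (is_derive1_powR alpha r0).
by rewrite mulrC.
Qed.

(* In the variable [s = r `^ alpha] the weights and the nonlinearity combine
   into [Lop] with the dimension n, thanks to the two relations between the
   exponents. *)
Lemma pressure_equation_of_polar_pde (alpha n c e : R) P :
  2 < n -> 0 < alpha -> alpha * (n - 2) = d%:R - 2 + c -> e - c + 2 = 2 * alpha ->
  Ck_polar 2 P -> (forall r t, 0 < r -> sphere t -> 0 < P r t) ->
  let v : fct := fun r t => ((n - 1)^-1 * P (r `^ alpha) t) `^ (- ((n - 2) / 2)) in
  (forall r t, 0 < r -> sphere t ->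
     \sum_(i < d) partial i (fun y => enorm y `^ c * partial i (cart v) y) (r *: t) +
     r `^ e * (v r t `^ (4 / (n - 2)) * v r t) = 0) ->
  forall s t, 0 < s -> sphere t ->
    P s t * Lop alpha n P s t =
      2 * (n - 1) ^+ 2 / (n - 2) + n / 2 * Dsq alpha P s t.
Proof.
move=> n2 a0 Hc He cP P0 v Hv s t s0 st.
pose m := (n - 2) / 2; pose k := (n - 1)^-1.
have m0 : 0 < m by rewrite divr_gt0// subr_gt0.
have k0 : 0 < k by rewrite invr_gt0; lra.
pose U : fct := fun r t => P (r `^ alpha) t.
have cU : Ck_polar 2 U by exact: Ck_polar_reparam.
have cU1 : Ck_polar 1 U by exact: (Ck_polarW _ cU).
have cP1 : Ck_polar 1 P by exact: (Ck_polarW _ cP).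
have cdU : Ck_polar 1 (dr U) by exact: (Ck_polar_dr cU).
have ctU i : Ck_polar 1 (tang i U) by exact: (Ck_polar_tang i cU).
have U0 r t' : 0 < r -> sphere t' -> 0 < U r t'.
  by move=> r0 st'; apply: P0 => //; exact: powR_gt0.
have ckU : Ck_polar 2 (fun r t => k * U r t).
  exact: (Ck_polar_mul (Ck_polar_cst 2 k) cU).
have kU0 r t' : 0 < r -> sphere t' -> 0 < k * U r t'.
  by move=> r0 st'; rewrite mulr_gt0// U0.
have cv : Ck_polar 2 v by exact: (Ck_polar_powR _ kU0 ckU).
have hpsi (c1 c2 y : R) : 0 < y ->
    is_derive y (1 : R) (fun y => c1 * (k * y) `^ c2) (c1 * c2 * k * (k * y) `^ (c2 - 1)).
  move=> y0; have ky0 : 0 < k * y by rewrite mulr_gt0.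
  have h1 : is_derive y (1 : R) (fun y => k * y) k.
    have := is_derive_mul (is_derive_cst k y (1 : R)) (is_derive_id y (1 : R)).
    by rewrite mul0r add0r mulr1.
  have h2 := @is_derive_comp1 _ _ (fun z => z `^ c2) (fun y => k * y) y 1 _ _
    (is_derive1_powR c2 ky0) h1.
  have h3 : is_derive y (1 : R) (fun y => c1 * (k * y) `^ c2) _ :=
    is_derive_mul (is_derive_cst c1 y (1 : R)) h2.
  by apply: (is_derive_eq h3); rewrite /= mul0r add0r; ring.
(* First two derivatives of y -> (k y)^(-m), left in the shape that [hpsi] returns for (1, -m) and
   then for the coefficient and exponent so obtained. *)
pose psi1 (y : R) := 1 * - m * k * (k * y) `^ (- m - 1).
pose psi2 (y : R) := 1 * - m * k * (- m - 1) * k * (k * y) `^ (- m - 1 - 1).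
have h0 (y : R) : 0 < y -> is_derive y (1 : R) (fun y => (k * y) `^ (- m)) (psi1 y).
  move=> y0; have := hpsi 1 (- m) y y0.
  rewrite (_ : (fun y => 1 * _) = (fun y => (k * y) `^ (- m)))//.
  by apply/funext => z; rewrite mul1r.
have h1 (y : R) : 0 < y -> is_derive y (1 : R) psi1 (psi2 y).
  by move=> y0; exact: hpsi.
have cpsi1 : Ck_polar 1 (fun r t => psi1 (U r t)).
  apply: Ck_polar_mul; first exact: Ck_polar_cst.
  by apply: (Ck_polar_powR _ kU0); exact: (Ck_polarW _ ckU).
have dv r t' : 0 < r -> sphere t' -> dr v r t' = psi1 (U r t') * dr U r t'.
  by move=> r0 st'; exact: (dr_comp r0 st' cU1 (h0 _ (U0 _ _ r0 st'))).
have tv i r t' : 0 < r -> sphere t' -> tang i v r t' = psi1 (U r t') * tang i U r t'.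
  by move=> r0 st'; exact: (tang_comp r0 st' i cU1 (h0 _ (U0 _ _ r0 st'))).
have ddv r t' : 0 < r -> sphere t' ->
    dr (dr v) r t' = psi2 (U r t') * dr U r t' ^+ 2 + psi1 (U r t') * dr (dr U) r t'.
  move=> r0 st'; rewrite (dr_eq dv r0 st') (dr_mul r0 st' cpsi1 cdU).
  rewrite (dr_comp r0 st' cU1 (h1 _ (U0 _ _ r0 st'))).
  by rewrite expr2 mulrA.
have ttv i r t' : 0 < r -> sphere t' -> tang i (tang i v) r t' =
    psi2 (U r t') * (tang i U r t' * tang i U r t') + psi1 (U r t') * tang i (tang i U) r t'.
  move=> r0 st'; rewrite (@tang_eq _ _ i (tang i v) (fun r t => psi1 (U r t) * tang i U r t)
    r t' (fun t st => tv i r t r0 st) st').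
  rewrite (tang_mul r0 st' i cpsi1 (ctU i)).
  rewrite (tang_comp r0 st' i cU1 (h1 _ (U0 _ _ r0 st'))).
  by rewrite mulrA.
have dU r t' : 0 < r -> sphere t' ->
    dr U r t' = alpha * r `^ (alpha - 1) * dr P (r `^ alpha) t'.
  by move=> r0 st'; exact: dr_reparam.
have ddU r t' : 0 < r -> sphere t' -> dr (dr U) r t' =
    alpha * (alpha - 1) * r `^ (alpha - 1 - 1) * dr P (r `^ alpha) t' +
    alpha ^+ 2 * r `^ (alpha - 1) ^+ 2 * dr (dr P) (r `^ alpha) t'.
  move=> r0 st'; rewrite (dr_eq dU r0 st').
  have c1 : Ck_polar 1 (fun r (_ : 'rV[R]_d) => alpha * r `^ (alpha - 1)).
    exact: (Ck_polar_mul (Ck_polar_cst 1 alpha) (Ck_polar_rad 1 _)).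
  have c2 : Ck_polar 1 (fun r t => dr P (r `^ alpha) t).
    exact: (Ck_polar_reparam alpha (Ck_polar_dr cP)).
  rewrite (dr_mul r0 st' c1 c2) (dr_scale r0 st' alpha (Ck_polar_rad 1 _)).
  rewrite (dr_rad t' r0 (alpha - 1)) (dr_reparam alpha (Ck_polar_dr cP) r0 st').
  move: (dr P _ _) (dr (dr P) _ _) (r `^ (alpha - 1 - 1)) (r `^ (alpha - 1)) => *; ring.
(* The equation is read at the radius whose power alpha is the given s. *)
pose r := s `^ alpha^-1.
have r0 : 0 < r by exact: powR_gt0.
have rs : r `^ alpha = s by rewrite -powRrM mulVf ?powRr1 ?ltW// gt_eqF.
have := Hv r t r0 st.
rewrite (divergence_polar c cv r0 st) laplace_beltrami_tang.
rewrite (eq_bigr _ (fun i _ => ttv i r t r0 st)) big_split /= -!mulr_sumr.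
rewrite (ddv r t r0 st) (dv r t r0 st) (ddU r t r0 st) (dU r t r0 st).
have -> : \sum_(i < d) tang i U r t * tang i U r t =
    \sum_(i < d) tang i P s t * tang i P s t.
  by apply: eq_bigr => i _; rewrite -rs.
have -> : \sum_(i < d) tang i (tang i U) r t = \sum_(i < d) tang i (tang i P) s t.
  by apply: eq_bigr => i _; rewrite -rs.
have UE : U r t = P s t by rewrite /U rs.
have vE : v r t = (k * P s t) `^ (- m) by rewrite /v rs.
(* This is the relation e - c + 2 = 2 alpha, exponentiated. *)
have eE : r `^ e = r `^ c * (s ^+ 2 / r ^+ 2).
  rewrite (_ : e = c + (alpha * 2 - 2%:R)); last by move: He; lra.
  rewrite powRD; last by apply/implyP => _; rewrite gt_eqF.
  rewrite powRB; last by apply/implyP => _; rewrite gt_eqF.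
  by rewrite powRrM rs !powR_mulrn ?ltW.
have p0 := P0 _ _ s0 st.
have z0 : 0 < k * P s t by rewrite mulr_gt0.
(* Here -m times 4/(n - 2) equals -2, so the nonlinearity becomes v times an integer power of the
   pressure. *)
have vq : v r t `^ (4 / (n - 2)) = (k * P s t) ^- 2.
  rewrite vE -powRrM (_ : - m * (4 / (n - 2)) = - 2%:R); last first.
    by rewrite /m; field; rewrite subr_eq0 gt_eqF.
  by rewrite powR_invn// ltW.
rewrite UE vq vE eE rs !(powR_sub1 _ r0) rs /psi1 /psi2
  !(powR_sub1 _ z0) LopE /Dsq DdotE.
have c0 : 0 < r `^ c by exact: powR_gt0.
have w0 : 0 < (k * P s t) `^ (- m) by exact: powR_gt0.
move: c0 w0.
move: (\sum_(i < d) tang i P s t * tang i P s t)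
  (\sum_(i < d) tang i (tang i P) s t) (dr P s t) (dr (dr P) s t)
  ((k * P s t) `^ (- m)) (r `^ c) => G2 Lap P1 P2 w rc rc0 w0.
move: (P s t) p0 z0 => p p0 z0 E.
have nE : n = 2 * m + 2 by rewrite /m; field.
have cE : c = alpha * (2 * m) - d%:R + 2.
  by rewrite (_ : 2 * m = n - 2); [rewrite Hc; ring|rewrite nE; ring].
have kn : k = (2 * m + 1)^-1 by rewrite /k nE; congr (_^-1); ring.
have m1 : 2 * m + 1 != 0 by rewrite gt_eqF// addr_gt0// mulr_gt0.
move: (gt_eqF r0) (gt_eqF s0) (gt_eqF p0) (gt_eqF k0) => rn0 sn0 pn0 kn0.
pose Q := alpha ^+ 2 * P1 * P1 + G2 / s ^+ 2.
pose L := alpha ^+ 2 * P2 + alpha ^+ 2 * ((n - 1) / s) * P1 + Lap / s ^+ 2.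
(* With Q = |DP|^2 and L = L P, the equation factors through a positive quantity. The remaining
   bracket is the pressure equation, where m + 1 = n/2 and 1/(m k^2) = 2 (n - 1)^2/(n - 2). *)
have F : rc * w * (s / (r * (k * p))) ^+ 2 *
    (m * (m + 1) * k ^+ 2 * Q - m * k ^+ 2 * (p * L) + 1) = 0.
  rewrite -[RHS]E /Q /L nE cE.
  clear -rn0 sn0 pn0 kn0.
  clearbody r k m.
  by field; rewrite rn0 sn0 pn0 kn0.
move/eqP: F; rewrite mulf_eq0 gt_eqF/=; last first.
  apply: mulr_gt0; first exact: mulr_gt0.
  by apply: exprn_gt0; apply: divr_gt0 => //; exact: mulr_gt0.
move=> /eqP T; rewrite -/Q -/L; clearbody Q L.
have -> : p * L = (m + 1) * Q + (m * k ^+ 2)^-1.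
  have mk : m * k ^+ 2 != 0 by rewrite gt_eqF// mulr_gt0// exprn_gt0.
  apply: (mulfI mk); rewrite mulrDr mulfV//; clear -T; lra.
rewrite nE kn; clear -m1 m0; clearbody m.
have -> : 2 * m + 2 - 2 = 2 * m by ring.
have mn0 : m != 0 by rewrite gt_eqF.
by field; rewrite ?m1 ?mn0.
Qed.

End pressure_equation.

(** * Relations between the exponents *)

Section ckn_parameters.
Variables (R : realType) (d : nat) (a b : R).
Hypotheses (hd : (2 <= d)%N) (ha : a < a_c d) (hab3 : (3 <= d)%N -> a <= b)
  (hab2 : d = 2%N -> a < b) (hb : b < a + 1).
Local Notation n := (ckn_n d a b : R).
Local Notation p := (ckn_p d a b).
Local Notation alpha := (ckn_alpha d a b).

(** For d = 2 only 2(b - a) is left, positive by the strict inequality a < b; for d >= 3 the term d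
    - 2 is already at least 1. *)
Lemma ckn_denominator_gt0 : 0 < d%:R - 2 + 2 * (b - a).
Proof.
have [d2|d3] := eqVneq d 2%N.
  by move: (hab2 d2); rewrite d2; lra.
have {}d3 : (3 <= d)%N by rewrite ltn_neqAle eq_sym d3.
have : 3 <= d%:R :> R by rewrite ler_nat.
by move: (hab3 d3); lra.
Qed.

Lemma ckn_alpha_denominator_gt0 : 0 < a_c d - a + b.
Proof. by have := ckn_denominator_gt0; rewrite /a_c; lra. Qed.

Let q0 : 0 < 1 + a - b. Proof. by move: hb; lra. Qed.

Lemma ckn_n_gt2 : 2 < n.
Proof.
rewrite /ckn_n ltr_pdivlMr//; have := ckn_denominator_gt0; lra.
Qed.

Lemma ckn_alpha_gt0 : 0 < alpha.
Proof.
by rewrite /ckn_alpha divr_gt0 ?ckn_alpha_denominator_gt0// mulr_gt0// subr_gt0.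
Qed.

(** With D = d - 2 + 2(b - a) one has n - 2 = D/(1 + a - b) and alpha = (1 + a - b)(d - 2 - 2a)/D,
    so the product simplifies. *)
Lemma ckn_alpha_n : alpha * (n - 2) = d%:R - 2 - 2 * a.
Proof.
have h := ckn_alpha_denominator_gt0; rewrite /ckn_alpha /ckn_n /a_c in h *.
field; rewrite !gt_eqF//; lra.
Qed.

Lemma ckn_p_sub2 : p - 2 = 4 / (n - 2).
Proof.
have h := ckn_denominator_gt0; rewrite /ckn_p /ckn_n.
field; rewrite !gt_eqF//; lra.
Qed.

Lemma ckn_exponent : - (b * p) - - (2 * a) + 2 = 2 * alpha.
Proof.
have h := ckn_denominator_gt0; have h' := ckn_alpha_denominator_gt0.
rewrite /ckn_p /ckn_alpha /a_c in h' *.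
field; rewrite !gt_eqF//; lra.
Qed.

End ckn_parameters.

Theorem lemma2p1 (R : realType) (d : nat) (a b : R)
    (hd : (2 <= d)%N)
    (ha : a < a_c d)
    (hab3 : (3 <= d)%N -> a <= b)
    (hab2 : d = 2%N -> a < b)
    (hb : b < a + 1)
    (u : 'rV[R]_d -> R)
    (hu : Dloc a b u)
    (u_gt0 : forall x, x != 0 -> 0 < u x)
    (u_sol : weak_solution a b u)
    (w : R -> 'rV[R]_d -> R)
    (hw : forall r theta, 0 < r -> sphere theta ->
      u (r *: theta) = w (r `^ ckn_alpha d a b) theta) :
  let n := ckn_n d a b in
  let alpha := ckn_alpha d a b in
  let P := pressure n w in
  let L := Lop alpha n in
  let D := Dop alpha in
  Ck_polar 3 P ->
  forall r theta, 0 < r -> sphere theta ->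
    L P r theta =
      2 * (n - 1) ^+ 2 / (n - 2) * (P r theta)^-1 +
      n / 2 * Dsq alpha P r theta * (P r theta)^-1
    /\
    P r theta `^ (1 - n) * kop alpha n P r theta =
      Ddiv alpha n (fun s t =>
        (2^-1 * P s t `^ (1 - n)) *: D (Dsq alpha P) s t -
        (n^-1 * P s t `^ (1 - n) * L P s t) *: D P s t) r theta.
Proof.
move=> n alpha P L D cP r theta r0 st; rewrite /L /D.
have n2 : 2 < n by exact: ckn_n_gt2.
have al0 : 0 < alpha by exact: ckn_alpha_gt0.
have oP := @open_punctured R d.
(* As alpha is positive, every s is the power alpha of a radius, so u determines w everywhere. *)
have w0 s t : 0 < s -> sphere t -> 0 < w s t.
  move=> s0 st'; have s'0 : 0 < s `^ alpha^-1 by exact: powR_gt0.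
  have := hw _ _ s'0 st'; rewrite -powRrM mulVf ?gt_eqF// powRr1 ?ltW// => <-.
  by apply: u_gt0; exact: polar_neq0.
have P0 s t : 0 < s -> sphere t -> 0 < P s t.
  move=> s0 st'; rewrite mulr_gt0// ?powR_gt0 ?w0//.
  by rewrite subr_gt0 (lt_trans _ n2)// ltr1n.
(* The pressure transform is inverted and composed with s -> s^alpha. This rebuilds u in polar
   coordinates out of P, so that u inherits its regularity from P. *)
pose v s t := ((n - 1)^-1 * P (s `^ alpha) t) `^ (- ((n - 2) / 2)).
have vE s t : 0 < s -> sphere t -> v s t = u (s *: t).
  move=> s0 st'; rewrite hw// /v /P /pressure mulKf; last first.
    by rewrite gt_eqF// subr_gt0 (lt_trans _ n2)// ltr1n.
  rewrite -powRrM (_ : - (2 / (n - 2)) * - ((n - 2) / 2) = 1).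
    by rewrite powRr1// ltW// w0// powR_gt0.
  by field; rewrite subr_eq0 gt_eqF.
have uE x : punctured x -> cart v x = u x.
  move=> x0; rewrite /cart vE -?polar_decomp//; [exact: enorm_gt0|exact: sphere_unit].
have cv : Ck_polar 3 v.
  apply: Ck_polar_powR.
    move=> s t s0 st'; rewrite mulr_gt0 ?invr_gt0 ?P0 ?powR_gt0//.
    by rewrite subr_gt0 (lt_trans _ n2)// ltr1n.
  exact: (Ck_polar_mul (Ck_polar_cst 3 (n - 1)^-1) (Ck_polar_reparam alpha cP)).
have cu : Ck 3 punctured u by exact: Ck_eq oP uE (Ck_cart cv).
have pde s t : 0 < s -> sphere t ->
    \sum_(i < d) partial i (fun y => enorm y `^ (- (2 * a)) * partial i (cart v) y) (s *: t) +
    s `^ (- (b * ckn_p d a b)) * (v s t `^ (4 / (n - 2)) * v s t) = 0.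
  move=> s0 st'; have [G [_ iG hG] hsol] := u_sol.
  pose V x := enorm x `^ (- (b * ckn_p d a b)) * (`|u x| `^ (ckn_p d a b - 2) * u x).
  have cV : Ck 0 punctured V.
    apply: (@Ck_eq _ _ _ _ (fun x => enorm x `^ (- (b * ckn_p d a b)) *
      (u x `^ (ckn_p d a b - 2) * u x))) => //.
      by move=> x x0; rewrite /V ger0_norm// ltW// u_gt0.
    have cu0 : Ck 0 punctured u by exact: CkW cu.
    apply: Ck_mul => //; first exact: Ck_enorm_powR.
    by apply: Ck_mul => //; apply: Ck_powR => //.
  have cu2 : Ck 2 punctured u by exact: CkW cu.
  (* Functions supported away from the origin are among those allowed in the weak equation on the
     whole space. *)
  have tT (phi : 'rV[R]_d -> R) : test_function punctured phi -> test_function setT phi.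
    by move=> [sphi [K [cK _] K0]]; split => //; exists K.
  have VE : V (s *: t) =
      s `^ (- (b * ckn_p d a b)) * (v s t `^ (4 / (n - 2)) * v s t).
    rewrite /V (enorm_polar s0 st') -(vE _ _ s0 st').
    rewrite (ger0_norm (powR_ge0 _ _)); congr (_ * (_ `^ _ * _)).
    exact: ckn_p_sub2.
  have H := @weak_to_strong _ _ punctured u (fun x => enorm x `^ (- (2 * a))) V G
    oP iG hG cu2 (fun k => Ck_enorm_powR k _) cV (fun phi tphi => hsol phi (tT _ tphi))
    (s *: t) (polar_neq0 s0 st').
  rewrite VE in H.
  apply: (etrans _ H); apply: (congr1 (+%R^~ _)); apply: eq_bigr => i _.
  apply: (partial_eq i oP) (polar_neq0 s0 st') => y y0; congr (_ * _).
  exact: (partial_eq i oP uE y0).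
have cP2 : Ck_polar 2 P by exact: Ck_polarW cP.
have e1 : alpha * (n - 2) = d%:R - 2 - 2 * a by exact: ckn_alpha_n.
have e2 : - (b * ckn_p d a b) - - (2 * a) + 2 = 2 * alpha by exact: ckn_exponent.
have H := pressure_equation_of_polar_pde n2 al0 e1 e2 cP2 P0 pde.
split; last first.
  apply: (kop_divergence (K := 2 * (n - 1) ^+ 2 / (n - 2))) => //.
  by rewrite gt_eqF// (lt_trans _ n2).
have p0 := P0 _ _ r0 st.
rewrite -mulrDl -(H _ _ r0 st) mulrC mulKf// gt_eqF//.
Qed.
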